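(* There is an absolute constant $C>0$ such that the following holds. Let $A$ be an $m\times n$ matrix with $m>n$, all entries in $[-1,1]$, and no zero column. Let $\epsilon>0$ and let $\gamma\ge C\,n/\epsilon^2$ (with $\gamma\ge 1$). Let $B$ be the $n\times n$ output of DIMSUM run on $A$ with parameter $\gamma$, and let $D$ be the $n\times n$ diagonal matrix with $d_{ii}=\|c_i\|$. Then, with probability at least $1/2$, $$\frac{\|DBD-A^TA\|_2}{\|A^TA\|_2}\le \epsilon,$$ where $\|\cdot\|_2$ denotes the spectral norm.
   Context: Let $A=(a_{ki})$ be an $m\times n$ real matrix with rows $r_1,\dots,r_m$ and columns $c_1,\dots,c_n$; $\|c_i\|$ is the Euclidean norm of column $i$ (assumed nonzero). DIMSUM with parameter $\gamma>0$ is the following randomized procedure. For each pair of column indices $(i,j)$ set $p_{ij}=\min\!\left(1,\frac{\gamma}{\|c_i\|\|c_j\|}\right)$. For each row $k$ and each pair $(i,j)$ with $a_{ki}a_{kj}\neq 0$, independently (over all $k$ and all pairs) with probability $p_{ij}$ the value $a_{ki}a_{kj}$ is emitted to key $(i,j)$ (one ''emission''); equivalently let $X_{ijk}$ equal $a_{ki}a_{kj}$ with probability $p_{ij}$ and $0$ otherwise. The output is the $n\times n$ matrix $B$ with $b_{ij}=\frac{1}{\gamma}\sum_{k=1}^m X_{ijk}$ if $\frac{\gamma}{\|c_i\|\|c_j\|}\le 1$, and $b_{ij}=\frac{1}{\|c_i\|\|c_j\|}\sum_{k=1}^m X_{ijk}$ otherwise. Thus $\mathbb{E}[b_{ij}]=\frac{c_i^Tc_j}{\|c_i\|\|c_j\|}$.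 *)

(* Defs.v *)
From Stdlib Require Import Reals List ClassicalEpsilon ClassicalDescription.
Import ListNotations.
Open Scope R_scope.

Fixpoint sumR (N : nat) (f : nat -> R) : R :=
  match N with O => 0 | S N' => sumR N' f + f N' end.

Fixpoint prodR (N : nat) (f : nat -> R) : R :=
  match N with O => 1 | S N' => prodR N' f * f N' end.

(* A real m x n matrix is a function A : nat -> nat -> R, entry (k,i) = a_{ki},
   meaningful for k < m, i < n. *)

Definition colnorm (m : nat) (A : nat -> nat -> R) (i : nat) : R :=
  sqrt (sumR m (fun k => A k i * A k i)).

Definition vnorm (n : nat) (x : nat -> R) : R :=
  sqrt (sumR n (fun i => x i * x i)).

Definition mulmv (n : nat) (M : nat -> nat -> R) (x : nat -> R) : nat -> R :=
  fun i => sumR n (fun j => M i j * x j).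

Definition Rsup (E : R -> Prop) : R := epsilon (inhabits 0) (is_lub E).

Definition opnorm (n : nat) (M : nat -> nat -> R) : R :=
  Rsup (fun r => exists x : nat -> R, vnorm n x = 1 /\ r = vnorm n (mulmv n M x)).

Definition AtA (m : nat) (A : nat -> nat -> R) : nat -> nat -> R :=
  fun i j => sumR m (fun k => A k i * A k j).

Definition pij (m : nat) (A : nat -> nat -> R) (gamma : R) (i j : nat) : R :=
  Rmin 1 (gamma / (colnorm m A i * colnorm m A j)).

(* An outcome of the randomness: a list of m*n*n coin flips; coin (k,i,j)
   says whether a_ki a_kj is emitted to key (i,j). *)
Definition coin (n : nat) (w : list bool) (k i j : nat) : bool :=
  nth (k * n * n + i * n + j) w false.

Definition Xv (m n : nat) (A : nat -> nat -> R) (w : list bool) (i j k : nat) : R :=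
  if coin n w k i j then A k i * A k j else 0.

Definition dimsumB (m n : nat) (A : nat -> nat -> R) (gamma : R) (w : list bool)
  : nat -> nat -> R :=
  fun i j =>
    if Rle_dec (gamma / (colnorm m A i * colnorm m A j)) 1
    then / gamma * sumR m (fun k => Xv m n A w i j k)
    else / (colnorm m A i * colnorm m A j) * sumR m (fun k => Xv m n A w i j k).

Fixpoint bool_lists (N : nat) : list (list bool) :=
  match N with
  | O => [nil]
  | S N' => flat_map (fun l => [true :: l; false :: l]) (bool_lists N')
  end.

Definition weight (m n : nat) (A : nat -> nat -> R) (gamma : R) (w : list bool) : R :=
  prodR m (fun k => prodR n (fun i => prodR n (fun j =>
    if coin n w k i j then pij m A gamma i j else 1 - pij m A gamma i j))).

Definition indic (P : Prop) : R :=
  if excluded_middle_informative P then 1 else 0.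

Definition dimsum_prob (m n : nat) (A : nat -> nat -> R) (gamma : R)
  (E : list bool -> Prop) : R :=
  fold_right Rplus 0
    (map (fun w => weight m n A gamma w * indic (E w)) (bool_lists (m * n * n))).

Definition DBD_minus_AtA (m n : nat) (A : nat -> nat -> R) (gamma : R) (w : list bool)
  : nat -> nat -> R :=
  fun i j => colnorm m A i * dimsumB m n A gamma w i j * colnorm m A j - AtA m A i j.

(* Main.v *)
(* The matrix E = DBD - A^T A has independent centred entries
   E_ij = sum_k a_ki a_kj (xi_kij / p_ij - 1).  With S = ||A^T A||_2, which dominates every
   |c_i|^2, and gamma >= 1, each entry is a sum of independent centred variables of size at
   most S / gamma and total variance at most S^2 / gamma, so E is S / sqrt gamma times a
   matrix X with independent entries that are subexponential at scale O(1).  It remains to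
   see that such an X has norm O(sqrt n) with probability 1/2, with no logarithmic loss.
   This follows Friedman, Kahn and Szemeredi: round unit vectors to vectors z, w with entries
   0 or +-2^s / (2 sqrt n), and split z^T X w according to whether
   |z_i w_j| <= 1 / (4 sqrt n) or not.  The light part is controlled for all pairs (z, w) at
   once by Chernoff's bound; the heavy part is a weighted sum, over pairs of levels (s, t), of
   signed sums of X over the rectangle formed by two level sets, each controlled by Chernoff's
   bound.  Both union bounds use weights: a deviation may be as large as minus the logarithm
   of a subprobability weight of the index, and product weights make the total explicit. *)
Require Import Defs.
From Stdlib Require Import Reals List ClassicalEpsilon ClassicalDescription.
From Stdlib Require Import Lra Lia.
Import ListNotations.
Open Scope R_scope.

(** * Finite sums, products and product measures *)

Lemma sumR_ext n f g :
  (forall i, (i < n)%nat -> f i = g i) -> sumR n f = sumR n g.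
Proof.
  induction n as [|n IH]; intros H; simpl; [reflexivity|].
  rewrite IH by (intros; apply H; lia). rewrite H by lia. reflexivity.
Qed.

Lemma sumR_le n f g :
  (forall i, (i < n)%nat -> f i <= g i) -> sumR n f <= sumR n g.
Proof.
  induction n as [|n IH]; intros H; simpl; [lra|].
  apply Rplus_le_compat; [apply IH; intros; apply H|apply H]; lia.
Qed.

Lemma sumR_nonneg n f : (forall i, (i < n)%nat -> 0 <= f i) -> 0 <= sumR n f.
Proof.
  induction n as [|n IH]; intros H; simpl; [lra|].
  apply Rplus_le_le_0_compat; [apply IH; intros; apply H|apply H]; lia.
Qed.

Lemma sumR_plus n f g : sumR n (fun i => f i + g i) = sumR n f + sumR n g.
Proof. induction n as [|n IH]; simpl; [|rewrite IH]; ring. Qed.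

Lemma sumR_scal n c f : sumR n (fun i => c * f i) = c * sumR n f.
Proof. induction n as [|n IH]; simpl; [|rewrite IH]; ring. Qed.

Lemma sumR_const n c : sumR n (fun _ => c) = INR n * c.
Proof. induction n as [|n IH]; [simpl; ring|]. rewrite S_INR. simpl. rewrite IH. ring. Qed.

Lemma sumR_swap m n (f : nat -> nat -> R) :
  sumR m (fun i => sumR n (fun j => f i j)) = sumR n (fun j => sumR m (fun i => f i j)).
Proof.
  induction m as [|m IH]; simpl.
  - symmetry. rewrite sumR_const. ring.
  - rewrite IH. symmetry. apply sumR_plus.
Qed.

Lemma sumR_mult m n f g :
  sumR m (fun i => sumR n (fun j => f i * g j)) = sumR m f * sumR n g.
Proof.
  rewrite <- (Rmult_comm (sumR n g)), <- sumR_scal.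
  apply sumR_ext; intros. rewrite sumR_scal. ring.
Qed.

Lemma sumR_shift n f : sumR (S n) f = f O + sumR n (fun i => f (S i)).
Proof.
  induction n as [|n IH]; [simpl; ring|].
  change (sumR (S (S n)) f) with (sumR (S n) f + f (S n)).
  rewrite IH. simpl. ring.
Qed.

Lemma sumR_term_le n f i :
  (i < n)%nat -> (forall j, (j < n)%nat -> 0 <= f j) -> f i <= sumR n f.
Proof.
  induction n as [|n IH]; intros Hi H; [lia|]. simpl.
  destruct (Nat.eq_dec i n) as [->|Hne].
  - pose proof (sumR_nonneg n f (fun j Hj => H j ltac:(lia))). lra.
  - pose proof (IH ltac:(lia) (fun j Hj => H j ltac:(lia))).
    pose proof (H n ltac:(lia)). lra.
Qed.

Lemma sumR_single n l g :
  (l < n)%nat -> sumR n (fun s => if Nat.eqb s l then g s else 0) = g l.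
Proof.
  induction n as [|n IH]; intros Hl; [lia|]. simpl.
  destruct (Nat.eqb_spec n l) as [->|Hne].
  - rewrite (sumR_ext l _ (fun _ => 0)).
    + rewrite sumR_const. ring.
    + intros i Hi. destruct (Nat.eqb_spec i l); [lia|reflexivity].
  - rewrite IH by lia. ring.
Qed.

Lemma prodR_ext n f g :
  (forall i, (i < n)%nat -> f i = g i) -> prodR n f = prodR n g.
Proof.
  induction n as [|n IH]; intros H; simpl; [reflexivity|].
  rewrite IH by (intros; apply H; lia). rewrite H by lia. reflexivity.
Qed.

Lemma prodR_mult n f g : prodR n (fun i => f i * g i) = prodR n f * prodR n g.
Proof. induction n as [|n IH]; simpl; [|rewrite IH]; ring. Qed.

Lemma prodR_exp n f : prodR n (fun i => exp (f i)) = exp (sumR n f).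
Proof.
  induction n as [|n IH]; simpl; [symmetry; apply exp_0|].
  rewrite IH, exp_plus. reflexivity.
Qed.

Lemma prodR_nonneg n f : (forall i, (i < n)%nat -> 0 <= f i) -> 0 <= prodR n f.
Proof.
  induction n as [|n IH]; intros H; simpl; [lra|].
  apply Rmult_le_pos; [apply IH; intros; apply H|apply H]; lia.
Qed.

Lemma prodR_le n f g :
  (forall i, (i < n)%nat -> 0 <= f i <= g i) -> prodR n f <= prodR n g.
Proof.
  induction n as [|n IH]; intros H; simpl; [lra|].
  apply Rmult_le_compat.
  - apply prodR_nonneg. intros; apply H; lia.
  - apply H; lia.
  - apply IH. intros; apply H; lia.
  - apply H; lia.
Qed.

Lemma prodR_one n : prodR n (fun _ => 1) = 1.
Proof. induction n as [|n IH]; simpl; [|rewrite IH]; ring. Qed.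

Lemma prodR_shift n f : prodR (S n) f = f O * prodR n (fun i => f (S i)).
Proof.
  induction n as [|n IH]; [simpl; ring|].
  change (prodR (S (S n)) f) with (prodR (S n) f * f (S n)).
  rewrite IH. simpl. ring.
Qed.

Lemma prodR_add a b f :
  prodR (a + b) f = prodR a f * prodR b (fun j => f (a + j)%nat).
Proof.
  induction b as [|b IH]; simpl; [rewrite Nat.add_0_r; ring|].
  rewrite Nat.add_succ_r. simpl. rewrite IH. ring.
Qed.

Lemma prodR_mul a b f :
  prodR (a * b) f = prodR a (fun i => prodR b (fun j => f (i * b + j)%nat)).
Proof.
  induction a as [|a IH]; simpl; [reflexivity|].
  rewrite Nat.add_comm, prodR_add, IH. reflexivity.
Qed.

(** * Sums over finite lists *)

Definition lsum {T : Type} (l : list T) (f : T -> R) : R := fold_right Rplus 0 (map f l).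

Lemma lsum_cons {T} (t : T) l f : lsum (t :: l) f = f t + lsum l f.
Proof. reflexivity. Qed.

Lemma lsum_app {T} (l l' : list T) f : lsum (l ++ l') f = lsum l f + lsum l' f.
Proof.
  induction l as [|t l IH]; [unfold lsum; simpl; ring|].
  rewrite <- app_comm_cons, !lsum_cons, IH. ring.
Qed.

Lemma lsum_ext {T} (l : list T) f g :
  (forall t, In t l -> f t = g t) -> lsum l f = lsum l g.
Proof.
  induction l as [|t l IH]; intros H; [reflexivity|]. rewrite !lsum_cons.
  rewrite IH, H; simpl; auto. intros; apply H; simpl; auto.
Qed.

Lemma lsum_le {T} (l : list T) f g :
  (forall t, In t l -> f t <= g t) -> lsum l f <= lsum l g.
Proof.
  induction l as [|t l IH]; intros H; [apply Rle_refl|]. rewrite !lsum_cons.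
  apply Rplus_le_compat; [apply H; simpl; auto|].
  apply IH; intros; apply H; simpl; auto.
Qed.

Lemma lsum_scal {T} (l : list T) c f : lsum l (fun t => c * f t) = c * lsum l f.
Proof.
  induction l as [|t l IH]; [unfold lsum; simpl; ring|]. rewrite !lsum_cons, IH. ring.
Qed.

Lemma lsum_plus {T} (l : list T) f g : lsum l (fun t => f t + g t) = lsum l f + lsum l g.
Proof.
  induction l as [|t l IH]; [unfold lsum; simpl; ring|]. rewrite !lsum_cons, IH. ring.
Qed.

Lemma lsum_map {T U} (h : T -> U) (l : list T) f : lsum (map h l) f = lsum l (fun t => f (h t)).
Proof. unfold lsum. rewrite map_map. reflexivity. Qed.

Lemma lsum_flat_map {T U} (h : T -> list U) (l : list T) f :
  lsum (flat_map h l) f = lsum l (fun t => lsum (h t) f).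
Proof.
  induction l as [|t l IH]; [reflexivity|].
  simpl. rewrite lsum_app, IH, lsum_cons. reflexivity.
Qed.

Lemma lsum_list_prod {T U} (l : list T) (l' : list U) f :
  lsum (list_prod l l') f = lsum l (fun t => lsum l' (fun u => f (t, u))).
Proof.
  induction l as [|t l IH]; [reflexivity|].
  simpl. rewrite lsum_app, lsum_map, IH, lsum_cons. reflexivity.
Qed.

Lemma lsum_mult {T U} (l : list T) (l' : list U) f g :
  lsum (list_prod l l') (fun p => f (fst p) * g (snd p)) = lsum l f * lsum l' g.
Proof.
  rewrite lsum_list_prod, Rmult_comm, <- lsum_scal.
  apply lsum_ext; intros. simpl. rewrite lsum_scal. ring.
Qed.

Lemma lsum_swap {T U} (l : list T) (l' : list U) (f : T -> U -> R) :
  lsum l (fun t => lsum l' (f t)) = lsum l' (fun u => lsum l (fun t => f t u)).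
Proof.
  induction l as [|t l IH].
  - change (0 = lsum l' (fun _ => 0)).
    rewrite (lsum_ext l' _ (fun _ => 0 * 0)) by (intros; ring).
    rewrite lsum_scal. ring.
  - rewrite lsum_cons, IH, <- lsum_plus. reflexivity.
Qed.

Lemma lsum_nonneg {T} (l : list T) f : (forall t, In t l -> 0 <= f t) -> 0 <= lsum l f.
Proof.
  induction l as [|t l IH]; intros H; [apply Rle_refl|]. rewrite lsum_cons.
  apply Rplus_le_le_0_compat; [apply H; simpl; auto|].
  apply IH; intros; apply H; simpl; auto.
Qed.

Lemma lsum_term_le {T} (l : list T) f t :
  In t l -> (forall t, 0 <= f t) -> f t <= lsum l f.
Proof.
  induction l as [|u l IH]; intros Ht H; [destruct Ht|]. rewrite lsum_cons.
  destruct Ht as [->|Ht].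
  - pose proof (lsum_nonneg l f (fun t _ => H t)). lra.
  - pose proof (IH Ht H). pose proof (H u). lra.
Qed.

(** * Vectors over a finite alphabet, and independent coins *)

Fixpoint vecs {T : Type} (n : nat) (l : list T) : list (list T) :=
  match n with
  | O => [nil]
  | S n' => flat_map (fun t => map (cons t) (vecs n' l)) l
  end.

Lemma in_vecs {T} n (l : list T) (c : nat -> T) :
  (forall i, (i < n)%nat -> In (c i) l) -> In (map c (seq 0 n)) (vecs n l).
Proof.
  revert c. induction n as [|n IH]; intros c H; [left; reflexivity|].
  simpl. apply in_flat_map. exists (c O). split; [apply H; lia|].
  apply in_map. rewrite <- seq_shift, map_map. apply IH. intros; apply H; lia.
Qed.

Lemma vecs_nth {T} n (l : list T) v d i :
  In v (vecs n l) -> (i < n)%nat -> In (nth i v d) l.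
Proof.
  revert v i. induction n as [|n IH]; intros v i Hv Hi; [lia|].
  simpl in Hv. apply in_flat_map in Hv as (t & Ht & Hv).
  apply in_map_iff in Hv as (v' & <- & Hv').
  destruct i as [|i]; [exact Ht|].
  apply (IH v' i Hv'). lia.
Qed.

Lemma nth_map_seq {T} n (c : nat -> T) d i :
  (i < n)%nat -> nth i (map c (seq 0 n)) d = c i.
Proof.
  intros Hi. rewrite (nth_indep _ d (c O)) by (rewrite length_map, length_seq; exact Hi).
  rewrite map_nth, seq_nth by exact Hi. reflexivity.
Qed.

(** Product weights factor over coordinates; this is what makes the totals in the union bounds
    computable. *)
Lemma lsum_vecs_exp {T} n (l : list T) (d : T) h :
  lsum (vecs n l) (fun v => exp (sumR n (fun i => h (nth i v d)))) =
  lsum l (fun t => exp (h t)) ^ n.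
Proof.
  induction n as [|n IH]; [unfold lsum; simpl; rewrite exp_0; ring|].
  simpl vecs. rewrite lsum_flat_map. simpl pow.
  rewrite (Rmult_comm (lsum l _)), <- lsum_scal.
  apply lsum_ext; intros t _. rewrite lsum_map, <- IH, Rmult_comm, <- lsum_scal.
  apply lsum_ext; intros v _. rewrite sumR_shift, exp_plus. reflexivity.
Qed.

Lemma lsum_bool_lists N (g : nat -> bool -> R) :
  lsum (bool_lists N) (fun w => prodR N (fun i => g i (nth i w false))) =
  prodR N (fun i => g i true + g i false).
Proof.
  revert g. induction N as [|N IH]; intros g; [unfold lsum; simpl; ring|].
  simpl bool_lists. rewrite lsum_flat_map, prodR_shift.
  rewrite <- (IH (fun i => g (S i))), <- lsum_scal.
  apply lsum_ext; intros w _. rewrite !lsum_cons, !prodR_shift.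
  unfold lsum. simpl. ring.
Qed.

Lemma div_mod_mul_add n q j :
  (j < n)%nat -> ((q * n + j) / n = q /\ (q * n + j) mod n = j)%nat.
Proof.
  intros Hj. split.
  - rewrite Nat.div_add_l, Nat.div_small by lia. lia.
  - rewrite Nat.add_comm, Nat.Div0.mod_add, Nat.mod_small by lia. reflexivity.
Qed.

(** Independence of the coins: a product with one factor per coin sums coin by coin. The flat index
    [q] decodes to row [q / n / n] and key [((q / n) mod n, q mod n)]. *)
Lemma lsum_coins m n (G : nat -> nat -> nat -> bool -> R) :
  lsum (bool_lists (m * n * n))
    (fun w => prodR m (fun k => prodR n (fun i => prodR n (fun j =>
       G k i j (coin n w k i j))))) =
  prodR m (fun k => prodR n (fun i => prodR n (fun j => G k i j true + G k i j false))).
Proof.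
  transitivity (prodR (m * n * n) (fun q =>
    G (q / n / n)%nat ((q / n) mod n)%nat (q mod n)%nat true +
    G (q / n / n)%nat ((q / n) mod n)%nat (q mod n)%nat false)).
  - rewrite <- (lsum_bool_lists (m * n * n)
      (fun q b => G (q / n / n)%nat ((q / n) mod n)%nat (q mod n)%nat b)).
    apply lsum_ext; intros w _. rewrite (prodR_mul (m * n) n), prodR_mul.
    apply prodR_ext; intros k _. apply prodR_ext; intros i Hi. apply prodR_ext; intros j Hj.
    destruct (div_mod_mul_add n (k * n + i) j Hj) as [-> ->].
    destruct (div_mod_mul_add n k i Hi) as [-> ->]. unfold coin.
    replace (k * n * n + i * n + j)%nat with ((k * n + i) * n + j)%nat by ring. reflexivity.
  - rewrite (prodR_mul (m * n) n), prodR_mul.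
    apply prodR_ext; intros k _. apply prodR_ext; intros i Hi. apply prodR_ext; intros j Hj.
    destruct (div_mod_mul_add n (k * n + i) j Hj) as [-> ->].
    destruct (div_mod_mul_add n k i Hi) as [-> ->]. reflexivity.
Qed.

(** * Norms and dyadic vectors *)

Lemma le_sqrt_of_sqr_le x y : x * x <= y -> x <= sqrt y.
Proof.
  intros H. apply Rle_trans with (Rabs x); [apply Rle_abs|].
  rewrite <- sqrt_Rsqr_abs. apply sqrt_le_1_alt. exact H.
Qed.

Lemma sumR_sqr_nonneg n f : 0 <= sumR n (fun i => f i * f i).
Proof. apply sumR_nonneg; intros. nra. Qed.

Lemma vnorm_nonneg n x : 0 <= vnorm n x.
Proof. apply sqrt_pos. Qed.

Lemma vnorm_sqr n x : vnorm n x * vnorm n x = sumR n (fun i => x i * x i).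
Proof. apply sqrt_sqrt, sumR_sqr_nonneg. Qed.

(** Induction on the length; the step is the two-dimensional inequality, which follows from the
    square of [vnorm n f * g n - vnorm n g * f n] being nonnegative. *)
Lemma cauchy_schwarz n f g : sumR n (fun i => f i * g i) <= vnorm n f * vnorm n g.
Proof.
  induction n as [|n IH].
  - unfold vnorm. simpl. rewrite sqrt_0. lra.
  - assert (HS : forall h, vnorm (S n) h = sqrt (vnorm n h * vnorm n h + h n * h n)).
    { intros h. rewrite vnorm_sqr. reflexivity. }
    rewrite !HS, <- sqrt_mult by nra. simpl.
    eapply Rle_trans; [apply Rplus_le_compat_r, IH|].
    apply le_sqrt_of_sqr_le.
    pose proof (Rle_0_sqr (vnorm n f * g n - vnorm n g * f n)) as H.
    unfold Rsqr in H. lra.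
Qed.

Lemma vnorm_scal n c x : 0 <= c -> vnorm n (fun i => c * x i) = c * vnorm n x.
Proof.
  intros Hc. unfold vnorm.
  rewrite (sumR_ext n _ (fun i => (c * c) * (x i * x i))) by (intros; ring).
  rewrite sumR_scal, sqrt_mult, sqrt_square; try nra. apply sumR_sqr_nonneg.
Qed.

Lemma vnorm_ext n x y : (forall i, (i < n)%nat -> x i = y i) -> vnorm n x = vnorm n y.
Proof. intros H. unfold vnorm. f_equal. apply sumR_ext; intros. rewrite H; auto. Qed.

Lemma abs_coord_le_vnorm n x i : (i < n)%nat -> Rabs (x i) <= vnorm n x.
Proof.
  intros Hi. apply le_sqrt_of_sqr_le. rewrite <- Rabs_mult, Rabs_pos_eq by nra.
  apply (sumR_term_le n (fun i => x i * x i)); [exact Hi|intros; nra].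
Qed.

Lemma vnorm_le n x B : 0 <= B -> sumR n (fun i => x i * x i) <= B * B -> vnorm n x <= B.
Proof.
  intros HB H. unfold vnorm. rewrite <- (sqrt_square B HB). apply sqrt_le_1_alt, H.
Qed.

(** * The operator norm as a supremum *)

Definition opnorm_set (n : nat) (M : nat -> nat -> R) (r : R) : Prop :=
  exists x : nat -> R, vnorm n x = 1 /\ r = vnorm n (mulmv n M x).

Lemma opnorm_set_ub n M :
  is_upper_bound (opnorm_set n M)
    (sqrt (sumR n (fun i => sumR n (fun j => M i j * M i j)))).
Proof.
  intros r (x & Hx & ->). unfold vnorm at 1. apply sqrt_le_1_alt, sumR_le; intros i Hi.
  pose proof (cauchy_schwarz n (M i) x) as H1.
  (* The negated row bounds the coordinate from below, so that its square is controlled. *)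
  pose proof (cauchy_schwarz n (fun j => - M i j) x) as H2.
  rewrite (sumR_ext n _ (fun j => (-1) * (M i j * x j))) in H2 by (intros; ring).
  rewrite sumR_scal in H2.
  assert (H3 : vnorm n (fun j => - M i j) = vnorm n (M i)).
  { unfold vnorm. f_equal. apply sumR_ext; intros; ring. }
  rewrite H3 in H2. rewrite Hx in *. rewrite <- (vnorm_sqr n (M i)).
  fold (mulmv n M x i) in *. pose proof (vnorm_nonneg n (M i)). nra.
Qed.

Definition basis_vec (i : nat) : nat -> R := fun j => if Nat.eqb j i then 1 else 0.

Lemma vnorm_basis_vec n i : (i < n)%nat -> vnorm n (basis_vec i) = 1.
Proof.
  intros Hi. unfold vnorm.
  rewrite (sumR_ext n _ (fun j => if Nat.eqb j i then 1 else 0)).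
  - rewrite (sumR_single n i (fun _ => 1) Hi). apply sqrt_1.
  - intros j _. unfold basis_vec. destruct (Nat.eqb j i); ring.
Qed.

Lemma mulmv_basis_vec n M i j : (j < n)%nat -> mulmv n M (basis_vec j) i = M i j.
Proof.
  intros Hj. unfold mulmv.
  rewrite (sumR_ext n _ (fun k => if Nat.eqb k j then M i k else 0)).
  - apply (sumR_single n j (fun k => M i k) Hj).
  - intros k _. unfold basis_vec. destruct (Nat.eqb k j); ring.
Qed.

(** [Rsup] picks a least upper bound by choice, so existence must be shown: the Frobenius norm
    bounds the set, and [0 < n] supplies a unit vector. *)
Lemma opnorm_lub n M : (0 < n)%nat -> is_lub (opnorm_set n M) (opnorm n M).
Proof.
  intros Hn. unfold opnorm, Rsup. apply epsilon_spec.
  destruct (completeness (opnorm_set n M)) as [l Hl].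
  - eexists; apply opnorm_set_ub.
  - exists (vnorm n (mulmv n M (basis_vec 0))), (basis_vec 0).
    split; [apply vnorm_basis_vec, Hn|reflexivity].
  - exists l. exact Hl.
Qed.

(** The diagonal entry is a coordinate of the image of a basis vector. For $A^TA$ this makes the
    spectral norm dominate every squared column norm. *)
Lemma diag_le_opnorm n M i : (i < n)%nat -> M i i <= opnorm n M.
Proof.
  intros Hi. destruct (opnorm_lub n M ltac:(lia)) as [Hub _].
  apply Rle_trans with (vnorm n (mulmv n M (basis_vec i))).
  - rewrite <- (mulmv_basis_vec n M i i Hi).
    eapply Rle_trans; [apply Rle_abs|apply abs_coord_le_vnorm, Hi].
  - apply Hub. exists (basis_vec i). split; [apply vnorm_basis_vec, Hi|reflexivity].
Qed.

Lemma opnorm_le n M B :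
  (0 < n)%nat -> (forall x, vnorm n x = 1 -> vnorm n (mulmv n M x) <= B) -> opnorm n M <= B.
Proof.
  intros Hn H. apply (proj2 (opnorm_lub n M Hn)). intros r (x & Hx & ->). auto.
Qed.

(* A code [(e, s)] stands for the real [e * 2 ^ s] with [e] in {0, 1, -1}; zero has a
   single code, so that sums over [codes N] do not count it once per level. *)
Definition cval (c : R * nat) : R := fst c * 2 ^ snd c.

Definition codes (N : nat) : list (R * nat) :=
  (0, O) :: flat_map (fun s => [(1, s); (-1, s)]) (seq 0 N).

Lemma in_codes N c :
  In c (codes N) -> (fst c = 0 \/ fst c = 1 \/ fst c = -1) /\
    ((snd c < N)%nat \/ c = (0, O)).
Proof.
  intros [<-|H]; [simpl; auto|].
  apply in_flat_map in H as (s & Hs & H). apply in_seq in Hs.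
  destruct H as [<-|[<-|[]]]; simpl; (split; [auto|left; lia]).
Qed.

Lemma dyadic_floor N x :
  1 <= x < 2 ^ N -> exists s, (s < N)%nat /\ 2 ^ s <= x < 2 ^ S s.
Proof.
  induction N as [|N IH]; intros [H1 H2]; [simpl in H2; lra|].
  destruct (Rlt_le_dec x (2 ^ N)) as [H|H].
  - destruct IH as (s & Hs & H3); [lra|]. exists s. split; [lia|exact H3].
  - exists N. split; [lia|lra].
Qed.

(** Rounding towards zero to a signed power of two loses at most half of [a], whence [a ^ 2 / 4];
    numbers below 1 in absolute value go to zero, which costs the additive 1. *)
Lemma dyadic_round N a :
  Rabs a < 2 ^ N ->
  exists c, In c (codes N) /\ (a - cval c) ^ 2 <= a ^ 2 / 4 + 1 /\ cval c ^ 2 <= a ^ 2.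
Proof.
  intros Ha. destruct (Rlt_le_dec (Rabs a) 1) as [H|H].
  - exists (0, O). split; [left; reflexivity|]. unfold cval; simpl.
    apply Rabs_def2 in H. nra.
  - destruct (dyadic_floor N (Rabs a)) as (s & Hs & H1 & H2); [lra|].
    assert (Hin : forall e, e = 1 \/ e = -1 -> In (e, s) (codes N)).
    { intros e He. right. apply in_flat_map. exists s. split; [apply in_seq; lia|].
      destruct He as [->| ->]; simpl; auto. }
    assert (0 < 2 ^ s) by (apply pow_lt; lra).
    destruct (Rle_dec 0 a) as [Hp|Hp].
    + rewrite Rabs_pos_eq in H1, H2 by exact Hp.
      exists (1, s). split; [auto|]. unfold cval. simpl in *. nra.
    + rewrite Rabs_left in H1, H2 by lra.
      exists (-1, s). split; [auto|]. unfold cval. simpl in *. nra.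
Qed.

(* The rounding error is a fixed proportion below the norm, so a linear form bounded on
   dyadic vectors is bounded on the whole ball, without any supremum argument. *)
Lemma dyadic_dual n N f K :
  (0 < n)%nat -> 2 * sqrt (INR n) < 2 ^ N ->
  (forall c : nat -> R * nat, (forall i, In (c i) (codes N)) ->
     sumR n (fun i => cval (c i) ^ 2) <= 4 * INR n ->
     sumR n (fun i => f i * cval (c i)) <= K) ->
  vnorm n f <= 2 * K / sqrt (INR n).
Proof.
  intros Hn HN H.
  assert (Hn' : 0 < INR n) by (apply lt_0_INR; lia).
  set (r := sqrt (INR n)). assert (Hr : 0 < r) by (apply sqrt_lt_R0, Hn').
  assert (Hrr : r * r = INR n) by (apply sqrt_sqrt; lra).
  (* The zero vector is admissible in [H]; this settles the case of a vanishing [f]. *)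
  assert (HK : 0 <= K).
  { specialize (H (fun _ => (0, O)) (fun _ => or_introl eq_refl)).
    rewrite (sumR_ext n _ (fun _ => 0)) in H by (intros; unfold cval; simpl; ring).
    rewrite (sumR_ext n (fun i => f i * _) (fun _ => 0)) in H
      by (intros; unfold cval; simpl; ring).
    rewrite !sumR_const in H. lra. }
  destruct (Rle_lt_or_eq_dec 0 (vnorm n f) (vnorm_nonneg n f)) as [Hf|Hf].
  2:{ rewrite <- Hf. apply Rmult_le_pos; [lra|]. left. apply Rinv_0_lt_compat, Hr. }
  (* At norm $2\sqrt n$ all coordinates are below [2 ^ N], and rounding, which increases no square,
     stays within the square norm [4 * INR n] allowed by [H]. *)
  set (v := fun i => 2 * r / vnorm n f * f i).
  assert (Hv : vnorm n v = 2 * r).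
  { unfold v. rewrite vnorm_scal; [field; lra|].
    apply Rmult_le_pos; [lra|]. left. apply Rinv_0_lt_compat, Hf. }
  assert (Hfv : sumR n (fun i => f i * v i) = 2 * r * vnorm n f).
  { rewrite (sumR_ext n _ (fun i => 2 * r / vnorm n f * (f i * f i)))
      by (intros; unfold v; ring).
    rewrite sumR_scal, <- vnorm_sqr. field. lra. }
  assert (Hround : forall i, exists c, In c (codes N) /\ ((i < n)%nat ->
     (v i - cval c) ^ 2 <= v i ^ 2 / 4 + 1 /\ cval c ^ 2 <= v i ^ 2)).
  { intros i. destruct (Nat.lt_ge_cases i n) as [Hi|Hi].
    - destruct (dyadic_round N (v i)) as (c & Hc & H1).
      + eapply Rle_lt_trans; [apply abs_coord_le_vnorm, Hi|]. rewrite Hv. exact HN.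
      + exists c. auto.
    - exists (0, O). split; [left; reflexivity|lia]. }
  set (c := fun i => proj1_sig (constructive_indefinite_description _ (Hround i))).
  assert (Hc : forall i, In (c i) (codes N) /\ ((i < n)%nat ->
     (v i - cval (c i)) ^ 2 <= v i ^ 2 / 4 + 1 /\ cval (c i) ^ 2 <= v i ^ 2)).
  { intros i. apply (proj2_sig (constructive_indefinite_description _ (Hround i))). }
  assert (Hvv : sumR n (fun i => v i ^ 2) = 4 * INR n).
  { rewrite (sumR_ext n _ (fun i => v i * v i)) by (intros; ring).
    rewrite <- vnorm_sqr, Hv, <- Hrr. ring. }
  assert (H1 : sumR n (fun i => f i * cval (c i)) <= K).
  { apply H; [intros; apply Hc|]. rewrite <- Hvv. apply sumR_le. intros i Hi.
    apply (proj2 (Hc i) Hi). }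
  set (e := fun i => v i - cval (c i)).
  (* The squared error is at most $4n/4+n=2n\le\frac94 n$. Hence $2r\|f\|\le K+\frac32 r\|f\|$, and
     the last term is absorbed on the left. *)
  assert (He : vnorm n e <= 3 / 2 * r).
  { apply vnorm_le; [lra|].
    apply Rle_trans with (sumR n (fun i => / 4 * v i ^ 2 + 1)).
    - apply sumR_le; intros i Hi. unfold e.
      pose proof (proj1 (proj2 (Hc i) Hi)). simpl in *. lra.
    - rewrite sumR_plus, sumR_scal, sumR_const, Hvv. nra. }
  pose proof (cauchy_schwarz n f e) as H2.
  assert (H3 : sumR n (fun i => f i * v i) =
               sumR n (fun i => f i * cval (c i)) + sumR n (fun i => f i * e i)).
  { rewrite <- sumR_plus. apply sumR_ext; intros. unfold e. ring. }
  apply Rmult_le_reg_r with r; [exact Hr|].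
  replace (2 * K / r * r) with (2 * K) by (field; lra).
  pose proof (Rmult_le_compat_l (vnorm n f) _ _ (Rlt_le _ _ Hf) He). nra.
Qed.

(** * Light and heavy parts of a bilinear form *)

(** The Frobenius inner product; [pairing n th th] is the squared Frobenius norm, which plays the
    part of the variance in Chernoff's bound. *)
Definition pairing (n : nat) (th x : nat -> nat -> R) : R :=
  sumR n (fun i => sumR n (fun j => th i j * x i j)).

Lemma pairing_ext n th th' x x' :
  (forall i j, (i < n)%nat -> (j < n)%nat -> th i j * x i j = th' i j * x' i j) ->
  pairing n th x = pairing n th' x'.
Proof. intros H. apply sumR_ext; intros. apply sumR_ext; intros. auto. Qed.

Lemma pairing_le n th th' x x' :
  (forall i j, (i < n)%nat -> (j < n)%nat -> th i j * x i j <= th' i j * x' i j) ->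
  pairing n th x <= pairing n th' x'.
Proof. intros H. apply sumR_le; intros. apply sumR_le; intros. auto. Qed.

Lemma pairing_plus n th th' x :
  pairing n (fun i j => th i j + th' i j) x = pairing n th x + pairing n th' x.
Proof.
  unfold pairing. rewrite <- sumR_plus. apply sumR_ext; intros i _.
  rewrite <- sumR_plus. apply sumR_ext; intros. ring.
Qed.

Lemma pairing_scal n a th x : pairing n (fun i j => a * th i j) x = a * pairing n th x.
Proof.
  unfold pairing. rewrite <- sumR_scal. apply sumR_ext; intros i _.
  rewrite <- sumR_scal. apply sumR_ext; intros. ring.
Qed.

Lemma pairing_sumR n N (th : nat -> nat -> nat -> R) x :
  pairing n (fun i j => sumR N (fun s => th s i j)) x = sumR N (fun s => pairing n (th s) x).
Proof.
  induction N as [|N IH]; simpl.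
  - unfold pairing. rewrite (sumR_ext n _ (fun _ => 0)), sumR_const; [ring|].
    intros i _. rewrite (sumR_ext n _ (fun _ => 0)), sumR_const; intros; ring.
  - rewrite (pairing_plus n (fun i j => sumR N (fun s => th s i j))), IH. reflexivity.
Qed.

Definition tensor (u v : nat -> R) : nat -> nat -> R := fun i j => u i * v j.

Lemma pairing_tensor_self n u v :
  pairing n (tensor u v) (tensor u v) =
  sumR n (fun i => u i ^ 2) * sumR n (fun j => v j ^ 2).
Proof.
  rewrite <- sumR_mult. apply sumR_ext; intros. apply sumR_ext; intros.
  unfold tensor. ring.
Qed.

(** Unit vectors are rounded to code values over $2\sqrt n$, so for nonzero codes the cutoff reads
    $|z_iw_j|\le 1/(4\sqrt n)$. Dividing by $\sqrt n$ brings the entries into $[-1,1]$, where the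
    moment bound applies. *)
Definition light (n : nat) (c d : nat -> R * nat) : nat -> nat -> R := fun i j =>
  if Rle_dec (2 ^ snd (c i) * 2 ^ snd (d j)) (sqrt (INR n))
  then cval (c i) * cval (d j) / sqrt (INR n) else 0.

(** The sign pattern of the level set [s]. The code of zero has level 0 and contributes the value 0
    there. *)
Definition slice (c : nat -> R * nat) (s : nat) : nat -> R := fun i =>
  if Nat.eqb s (snd (c i)) then fst (c i) else 0.

(* Minus the logarithm of a (sub)probability weight on dyadic vectors. *)
Definition light_penalty (n : nat) (c : nat -> R * nat) : R :=
  sumR n (fun i => cval (c i) ^ 2) + 2 * INR n + 1.

(* Minus the logarithm of a (sub)probability weight on pairs of a level and a vector with
   entries in {0, 1, -1}.  At level [s] a coordinate is nonzero with probability about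
   [4 ^ -s], the largest density possible for the level set of a vector of square norm [4 n]. *)
Definition heavy_penalty (n s : nat) (u : nat -> R) : R :=
  2 * INR s * sumR n (fun i => u i ^ 2) + 2 * INR n / 4 ^ s + INR s + 2.

Lemma four_pow s : 4 ^ s = 2 ^ s * 2 ^ s.
Proof. rewrite <- Rpow_mult_distr. f_equal; ring. Qed.

Lemma INR_le_pow2 N : INR N <= 2 ^ N.
Proof.
  induction N as [|N IH]; [simpl; lra|]. rewrite S_INR. simpl.
  pose proof (pow_R1_Rle 2 N ltac:(lra)). lra.
Qed.

Lemma sum_pow2_le N : sumR N (fun s => 2 ^ s) <= 2 ^ N.
Proof. induction N as [|N IH]; simpl; lra. Qed.

Lemma sum_pow2_linear N : sumR N (fun s => 2 ^ s * (INR s + 2)) = INR N * 2 ^ N.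
Proof.
  induction N as [|N IH]; [simpl; ring|]. rewrite S_INR. simpl. rewrite IH. ring.
Qed.

(** The full series sums to 20; the induction carries the exact tail. *)
Lemma sum_inv_pow2_linear_le N : sumR N (fun s => (8 * INR s + 2) / 2 ^ s) <= 20.
Proof.
  assert (H : sumR N (fun s => (8 * INR s + 2) / 2 ^ s) = 20 - (16 * INR N + 20) / 2 ^ N).
  { induction N as [|N IH]; [simpl; field|].
    rewrite S_INR. simpl. rewrite IH. field. apply pow_nonzero; lra. }
  rewrite H. pose proof (pos_INR N).
  assert (0 <= (16 * INR N + 20) / 2 ^ N); [|lra].
  apply Rmult_le_pos; [lra|]. left. apply Rinv_0_lt_compat, pow_lt. lra.
Qed.

(** A coordinate is seen only by the slice of its own level. Consequently a vector of square norm at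
    most $4n$ has at most $4n/4^s$ nonzero coordinates at level $s$. *)
Lemma slice_energy n N c :
  (forall i, (snd (c i) < N)%nat) ->
  sumR N (fun s => 4 ^ s * sumR n (fun i => slice c s i ^ 2)) =
  sumR n (fun i => cval (c i) ^ 2).
Proof.
  intros Hc.
  rewrite (sumR_ext N _ (fun s => sumR n (fun i => 4 ^ s * slice c s i ^ 2)))
    by (intros; symmetry; apply sumR_scal).
  rewrite sumR_swap. apply sumR_ext; intros i _.
  rewrite (sumR_ext N _ (fun s =>
    if Nat.eqb s (snd (c i)) then 4 ^ s * fst (c i) ^ 2 else 0)).
  - rewrite (sumR_single N _ (fun s => 4 ^ s * fst (c i) ^ 2) (Hc i)).
    unfold cval. rewrite four_pow. ring.
  - intros s _. unfold slice. destruct (Nat.eqb s (snd (c i))); ring.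
Qed.

(** The entry [(i, j)] meets a single pair of levels: if that pair passes the cutoff the entry is
    carried by [light], otherwise by the one surviving term of the double sum. *)
Lemma slice_decomp n N c d i j :
  (0 < n)%nat -> (forall i, (snd (c i) < N)%nat) -> (forall i, (snd (d i) < N)%nat) ->
  cval (c i) * cval (d j) =
  sqrt (INR n) * light n c d i j +
  sumR N (fun s => sumR N (fun t =>
    (if Rle_dec (2 ^ s * 2 ^ t) (sqrt (INR n)) then 0 else 2 ^ s * 2 ^ t) *
    tensor (slice c s) (slice d t) i j)).
Proof.
  intros Hn Hc Hd.
  set (h := fun s t => if Rle_dec (2 ^ s * 2 ^ t) (sqrt (INR n)) then 0 else 2 ^ s * 2 ^ t).
  rewrite (sumR_ext N _ (fun s => if Nat.eqb s (snd (c i))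
     then h s (snd (d j)) * (fst (c i) * fst (d j)) else 0)).
  - rewrite (sumR_single N _ (fun s => h s (snd (d j)) * (fst (c i) * fst (d j))) (Hc i)).
    unfold h, light, cval.
    assert (0 < sqrt (INR n)) by (apply sqrt_lt_R0, lt_0_INR; lia).
    destruct (Rle_dec _ _); field; lra.
  - intros s _. fold (h s).
    rewrite (sumR_ext N _ (fun t => if Nat.eqb t (snd (d j))
       then h s t * (slice c s i * fst (d j)) else 0)).
    + rewrite (sumR_single N _ (fun t => h s t * (slice c s i * fst (d j))) (Hd j)).
      unfold slice. destruct (Nat.eqb s (snd (c i))); ring.
    + intros t _. fold (h s t). unfold tensor, slice at 2.
      destruct (Nat.eqb t (snd (d j))); ring.
Qed.

(** The level set has at most $4n/4^s$ elements, so its entropy cost $2s\cdot 4n/4^s$, once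
    multiplied by $2^s$, still decays geometrically in $s$. This is what avoids a logarithmic
    loss. *)
Lemma slice_penalty_le n N c s :
  (forall i, (snd (c i) < N)%nat) -> (s < N)%nat ->
  sumR n (fun i => cval (c i) ^ 2) <= 4 * INR n ->
  2 ^ s * heavy_penalty n s (slice c s) <=
  INR n * ((8 * INR s + 2) / 2 ^ s) + 2 ^ s * (INR s + 2).
Proof.
  intros Hc Hs Hnorm. unfold heavy_penalty.
  set (a := sumR n (fun i => slice c s i ^ 2)).
  assert (Ha : 4 ^ s * a <= 4 * INR n).
  { eapply Rle_trans; [|exact Hnorm]. rewrite <- (slice_energy n N c Hc).
    apply (sumR_term_le N (fun s => 4 ^ s * sumR n (fun i => slice c s i ^ 2))); [exact Hs|].
    intros t _. apply Rmult_le_pos; [apply pow_le; lra|].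
    apply sumR_nonneg; intros; apply pow2_ge_0. }
  rewrite four_pow in *. set (p := 2 ^ s) in *.
  assert (Hp : 0 < p) by (apply pow_lt; lra). pose proof (pos_INR s) as Hs0.
  apply Rmult_le_reg_r with p; [exact Hp|].
  replace ((INR n * ((8 * INR s + 2) / p) + p * (INR s + 2)) * p)
    with (INR n * (8 * INR s + 2) + p * p * (INR s + 2)) by (field; lra).
  replace (p * (2 * INR s * a + 2 * INR n / (p * p) + INR s + 2) * p)
    with (2 * INR s * (p * p * a) + 2 * INR n + p * p * (INR s + 2)) by (field; lra).
  pose proof (Rmult_le_compat_l (2 * INR s) _ _ ltac:(lra) Ha). lra.
Qed.

(** Dropping the cutoff only increases the energy, and leaves a rank-one matrix of energy at most
    $(4n)^2/n$. *)
Lemma light_energy_le n c d :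
  (0 < n)%nat ->
  sumR n (fun i => cval (c i) ^ 2) <= 4 * INR n ->
  sumR n (fun i => cval (d i) ^ 2) <= 4 * INR n ->
  pairing n (light n c d) (light n c d) <= 16 * INR n.
Proof.
  intros Hn Hc Hd.
  assert (Hn' : 0 < INR n) by (apply lt_0_INR; lia).
  set (z := fun i => cval (c i)). set (w := fun i => cval (d i)).
  apply Rle_trans with (pairing n (fun i j => / INR n * tensor z w i j) (tensor z w)).
  - apply pairing_le; intros i j _ _. unfold light.
    assert (Hr : 0 < sqrt (INR n)) by (apply sqrt_lt_R0, Hn').
    assert (Hrr : sqrt (INR n) * sqrt (INR n) = INR n) by (apply sqrt_sqrt; lra).
    assert (H0 : / INR n * tensor z w i j * tensor z w i j =
             (tensor z w i j / sqrt (INR n)) * (tensor z w i j / sqrt (INR n))).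
    { rewrite <- Hrr at 1. field. lra. }
    rewrite H0. destruct (Rle_dec _ _); [apply Rle_refl|].
    rewrite Rmult_0_l. apply Rle_0_sqr.
  - rewrite pairing_scal, pairing_tensor_self.
    apply Rmult_le_reg_l with (INR n); [exact Hn'|].
    rewrite <- Rmult_assoc, Rinv_r, Rmult_1_l by lra.
    apply Rle_trans with ((4 * INR n) * (4 * INR n)); [|lra].
    apply Rmult_le_compat; auto; apply sumR_nonneg; intros; apply pow2_ge_0.
Qed.

(** The light part costs $30nr$ with $r=\sqrt n$. In the heavy part, the variance terms sum to at
    most $16nr$ and the penalties to at most $2\cdot 36n\cdot 4r$. *)
Lemma dyadic_bilinear_bound n N x c d :
  (0 < n)%nat -> 2 ^ N <= 4 * sqrt (INR n) ->
  (forall i, (snd (c i) < N)%nat) -> (forall i, (snd (d i) < N)%nat) ->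
  sumR n (fun i => cval (c i) ^ 2) <= 4 * INR n ->
  sumR n (fun i => cval (d i) ^ 2) <= 4 * INR n ->
  pairing n (light n c d) x <=
    pairing n (light n c d) (light n c d) + (light_penalty n c + light_penalty n d) ->
  (forall s t, (s < N)%nat -> (t < N)%nat ->
    pairing n (tensor (slice c s) (slice d t)) x <=
    pairing n (tensor (slice c s) (slice d t)) (tensor (slice c s) (slice d t)) +
    (heavy_penalty n s (slice c s) + heavy_penalty n t (slice d t))) ->
  pairing n (tensor (fun i => cval (c i)) (fun j => cval (d j))) x <=
  334 * INR n * sqrt (INR n).
Proof.
  intros Hn HN Hc Hd Hcn Hdn Hlight Hheavy.
  assert (Hn' : 1 <= INR n) by (change 1 with (INR 1); apply le_INR; lia).
  set (r := sqrt (INR n)) in *.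
  assert (Hr : 0 < r) by (apply sqrt_lt_R0; lra).
  assert (Hrr : r * r = INR n) by (apply sqrt_sqrt; lra).
  set (h := fun s t => if Rle_dec (2 ^ s * 2 ^ t) r then 0 else 2 ^ s * 2 ^ t).
  rewrite (pairing_ext n _ (fun i j => r * light n c d i j +
    sumR N (fun s => sumR N (fun t => h s t * tensor (slice c s) (slice d t) i j))) x x)
    by (intros; unfold tensor at 1; f_equal; apply slice_decomp; auto).
  rewrite (pairing_plus n (fun i j => r * light n c d i j)), pairing_scal.
  rewrite (pairing_sumR n N (fun s i j =>
    sumR N (fun t => h s t * tensor (slice c s) (slice d t) i j))).
  rewrite (sumR_ext N _ (fun s => sumR N (fun t =>
    h s t * pairing n (tensor (slice c s) (slice d t)) x))).
  2:{ intros s _.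
      rewrite (pairing_sumR n N (fun t i j => h s t * tensor (slice c s) (slice d t) i j)).
      apply sumR_ext; intros t _. apply pairing_scal. }
  (* Energy $16n$ plus two penalties of at most $4n+2n+1$ each, with $n\ge 1$. *)
  assert (HL : pairing n (light n c d) x <= 30 * INR n).
  { eapply Rle_trans; [exact Hlight|].
    pose proof (light_energy_le n c d Hn Hcn Hdn). unfold light_penalty. lra. }
  set (a := fun s => sumR n (fun i => slice c s i ^ 2)).
  set (b := fun s => sumR n (fun i => slice d s i ^ 2)).
  set (P := fun s => INR n * ((8 * INR s + 2) / 2 ^ s) + 2 ^ s * (INR s + 2)).
  (* The two sums are at most $20n$ and $N2^N\le 4^N\le 16n$. *)
  assert (HP : sumR N P <= 36 * INR n).
  { unfold P. rewrite sumR_plus, sumR_scal, sum_pow2_linear.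
    pose proof (sum_inv_pow2_linear_le N). pose proof (INR_le_pow2 N).
    assert (0 < 2 ^ N) by (apply pow_lt; lra). nra. }
  assert (Hnn : forall u, 0 <= sumR n (fun i => u i ^ 2)).
  { intros; apply sumR_nonneg; intros; apply pow2_ge_0. }
  assert (HH : sumR N (fun s => sumR N (fun t =>
      h s t * pairing n (tensor (slice c s) (slice d t)) x)) <=
    sumR N (fun s => sumR N (fun t =>
      / r * ((4 ^ s * a s) * (4 ^ t * b t)) + (P s * 2 ^ t + 2 ^ s * P t)))).
  { apply sumR_le; intros s Hs. apply sumR_le; intros t Ht.
    specialize (Hheavy s t Hs Ht). rewrite pairing_tensor_self in Hheavy.
    fold (a s) (b t) in Hheavy.
    pose proof (slice_penalty_le n N c s Hc Hs Hcn) as Hps. fold (P s) in Hps.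
    pose proof (slice_penalty_le n N d t Hd Ht Hdn) as Hpt. fold (P t) in Hpt.
    assert (H2s : 0 < 2 ^ s) by (apply pow_lt; lra).
    assert (H2t : 0 < 2 ^ t) by (apply pow_lt; lra).
    pose proof (Hnn (slice c s)) as Ha. fold (a s) in Ha.
    pose proof (Hnn (slice d t)) as Hb. fold (b t) in Hb.
    assert (Hab : 0 <= a s * b t) by (apply Rmult_le_pos; auto).
    assert (Hpen : 2 ^ s * 2 ^ t * (heavy_penalty n s (slice c s) + heavy_penalty n t (slice d t))
       <= P s * 2 ^ t + 2 ^ s * P t).
    { pose proof (Rmult_le_compat_r (2 ^ t) _ _ ltac:(lra) Hps).
      pose proof (Rmult_le_compat_l (2 ^ s) _ _ ltac:(lra) Hpt). lra. }
    rewrite !four_pow. unfold h. destruct (Rle_dec (2 ^ s * 2 ^ t) r) as [H|H].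
    - rewrite Rmult_0_l. apply Rplus_le_le_0_compat.
      + apply Rmult_le_pos; [left; apply Rinv_0_lt_compat, Hr|].
        apply Rmult_le_pos; apply Rmult_le_pos; nra.
      + eapply Rle_trans; [|exact Hpen]. apply Rmult_le_pos; [nra|].
        assert (Hq : forall q u, 0 <= heavy_penalty n q u).
        { intros q u. unfold heavy_penalty. pose proof (pos_INR q). pose proof (Hnn u).
          assert (0 <= 2 * INR n / 4 ^ q).
          { apply Rmult_le_pos; [lra|]. left. apply Rinv_0_lt_compat, pow_lt. lra. }
          nra. }
        pose proof (Hq s (slice c s)). pose proof (Hq t (slice d t)). lra.
    (* For a heavy pair $2^{s+t}>r$, so the variance $2^{s+t}a_sb_t$ is at most $4^sa_s\,4^tb_t/r$,
       whose sum over levels is a product of energies. *)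
    - assert (Hst : 0 < 2 ^ s * 2 ^ t) by nra.
      eapply Rle_trans; [apply Rmult_le_compat_l; [lra|exact Hheavy]|].
      rewrite Rmult_plus_distr_l. apply Rplus_le_compat; [|exact Hpen].
      replace (/ r * (2 ^ s * 2 ^ s * a s * (2 ^ t * 2 ^ t * b t)))
        with ((2 ^ s * 2 ^ t) * (a s * b t) * ((2 ^ s * 2 ^ t) / r)) by (field; lra).
      rewrite <- (Rmult_1_r (2 ^ s * 2 ^ t * (a s * b t))) at 1.
      apply Rmult_le_compat_l; [nra|].
      apply Rmult_le_reg_r with r; [exact Hr|]. unfold Rdiv.
      rewrite Rmult_assoc, Rinv_l by lra. lra. }
  assert (HE : sumR N (fun s => sumR N (fun t =>
      / r * ((4 ^ s * a s) * (4 ^ t * b t)) + (P s * 2 ^ t + 2 ^ s * P t))) =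
    / r * (sumR N (fun s => 4 ^ s * a s) * sumR N (fun t => 4 ^ t * b t)) +
    2 * (sumR N P * sumR N (fun t => 2 ^ t))).
  { rewrite (sumR_ext N _ (fun s =>
      / r * sumR N (fun t => (4 ^ s * a s) * (4 ^ t * b t)) +
      (sumR N (fun t => P s * 2 ^ t) + sumR N (fun t => 2 ^ s * P t)))).
    - rewrite !sumR_plus, sumR_scal, (sumR_mult N N (fun s => 4 ^ s * a s)).
      rewrite (sumR_mult N N P (fun t => 2 ^ t)), (sumR_mult N N (fun s => 2 ^ s) P). ring.
    - intros s _. rewrite <- sumR_scal, <- !sumR_plus. reflexivity. }
  rewrite HE in HH.
  unfold a, b in HH.
  rewrite (slice_energy n N c Hc), (slice_energy n N d Hd) in HH.
  assert (H1 : / r * (sumR n (fun i => cval (c i) ^ 2) * sumR n (fun i => cval (d i) ^ 2))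
     <= 16 * INR n * r).
  { apply Rmult_le_reg_l with r; [exact Hr|].
    rewrite <- Rmult_assoc, Rinv_r, Rmult_1_l by lra.
    replace (r * (16 * INR n * r)) with ((4 * INR n) * (4 * INR n)) by (rewrite <- Hrr; ring).
    apply Rmult_le_compat; auto. }
  assert (H2 : sumR N P * sumR N (fun t => 2 ^ t) <= 36 * INR n * (4 * r)).
  { pose proof (sum_pow2_le N) as H2N.
    apply Rle_trans with (36 * INR n * sumR N (fun t => 2 ^ t)).
    - apply Rmult_le_compat_r; [|exact HP]. apply sumR_nonneg; intros; apply pow_le; lra.
    - apply Rmult_le_compat_l; lra. }
  pose proof (Rmult_le_compat_l r _ _ (Rlt_le _ _ Hr) HL). lra.
Qed.

(** * Norm of a random matrix with subexponential entries *)

Lemma lsum_seq N f : lsum (seq 0 N) f = sumR N f.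
Proof.
  induction N as [|N IH]; [reflexivity|].
  rewrite seq_S, lsum_app, IH. unfold lsum. simpl. ring.
Qed.

Lemma indic_cases (Q : Prop) : (Q /\ indic Q = 1) \/ (~ Q /\ indic Q = 0).
Proof. unfold indic. destruct (excluded_middle_informative Q); auto. Qed.

(** Markov's inequality and the union bound in one: where [G] fails some [F t w] is positive, so the
    indicator of [G] plus the sum of the exponentials is at least 1 pointwise. *)
Lemma exponential_union_bound {W T : Type} (Om : list W) (P : W -> R) (tests : list T)
  (F : T -> W -> R) (G : W -> Prop) :
  (forall w, In w Om -> 0 <= P w) -> lsum Om P = 1 ->
  lsum tests (fun t => lsum Om (fun w => P w * exp (F t w))) <= 1 / 2 ->
  (forall w, (forall t, In t tests -> F t w <= 0) -> G w) ->
  1 / 2 <= lsum Om (fun w => P w * indic (G w)).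
Proof.
  intros HP H1 Hsum HG. rewrite lsum_swap in Hsum.
  assert (H : lsum Om P <= lsum Om (fun w => P w * indic (G w) +
                 lsum tests (fun t => P w * exp (F t w)))).
  { apply lsum_le; intros w Hw. rewrite lsum_scal.
    set (Z := lsum tests (fun t => exp (F t w))).
    assert (HZ : 1 <= indic (G w) + Z).
    { destruct (indic_cases (G w)) as [[Hg ->]|[Hg ->]].
      - assert (0 <= Z); [|lra]. apply lsum_nonneg; intros. left. apply exp_pos.
      - destruct (classic (exists t, In t tests /\ 0 < F t w)) as [(t & Ht & HF)|Hno].
        + apply Rle_trans with (exp (F t w)).
          * rewrite <- exp_0. left. apply exp_increasing, HF.
          * rewrite Rplus_0_l. apply (lsum_term_le tests (fun t => exp (F t w)) t Ht).
            intros; left; apply exp_pos.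
        + exfalso. apply Hg, HG. intros t Ht. apply Rnot_lt_le. intros HF. eauto. }
    pose proof (Rmult_le_compat_l (P w) _ _ (HP w Hw) HZ). lra. }
  rewrite lsum_plus in H. lra.
Qed.

Lemma exp_neg_1_le : exp (-1) <= / 2.
Proof.
  replace (-1) with (- (1)) by ring. rewrite exp_Ropp.
  apply Rinv_le_contravar; [lra|].
  pose proof (exp_ineq1_le 1). lra.
Qed.

Lemma exp_pow x k : exp x ^ k = exp (INR k * x).
Proof.
  induction k as [|k IH]; [simpl; rewrite Rmult_0_l, exp_0; reflexivity|].
  rewrite S_INR. simpl. rewrite IH, <- exp_plus. f_equal. ring.
Qed.

Lemma exp_le x y : x <= y -> exp x <= exp y.
Proof. intros [H|<-]; [left; apply exp_increasing, H|lra]. Qed.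

Lemma exp_neg_INR_le s : exp (- INR s) <= / 2 ^ s.
Proof.
  replace (- INR s) with (INR s * -1) by ring. rewrite <- exp_pow, <- pow_inv.
  apply pow_incr. split; [left; apply exp_pos|apply exp_neg_1_le].
Qed.

Lemma sum_half_pow_le N : sumR N (fun s => / 2 * / 2 ^ s) <= 1.
Proof.
  assert (H : sumR N (fun s => / 2 * / 2 ^ s) = 1 - / 2 ^ N).
  { induction N as [|N IH]; [simpl; field|]. simpl. rewrite IH. field.
    apply pow_nonzero; lra. }
  rewrite H. assert (0 < / 2 ^ N) by (apply Rinv_0_lt_compat, pow_lt; lra). lra.
Qed.

(** * Subprobability weights and the family of tests *)

Definition code_fun (l : list (R * nat)) : nat -> R * nat := fun i => nth i l (0, O).

(** One coordinate contributes at most $1+2\sum_s e^{-4^s}\le 3\le e^2$. The term $2n$ of the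
    penalty cancels the $n$-th power, and its final 1 leaves $e^{-1}\le 1/2$. *)
Lemma light_weight_le n N :
  lsum (vecs n (codes N)) (fun l => exp (- light_penalty n (code_fun l))) <= / 2.
Proof.
  rewrite (lsum_ext _ _ (fun l => exp (- (2 * INR n + 1)) *
    exp (sumR n (fun i => - cval (nth i l (0, O)) ^ 2)))).
  2:{ intros l _. rewrite <- exp_plus. f_equal. unfold light_penalty, code_fun.
      rewrite (sumR_ext n (fun i => - _) (fun i => (-1) * cval (nth i l (0, O)) ^ 2))
        by (intros; ring). rewrite sumR_scal. ring. }
  rewrite lsum_scal, (lsum_vecs_exp n (codes N) (0, O) (fun c => - cval c ^ 2)).
  assert (HQ : 0 <= lsum (codes N) (fun c => exp (- cval c ^ 2)) <= exp 2).
  { split; [apply lsum_nonneg; intros; left; apply exp_pos|].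
    apply Rle_trans with 3; [|pose proof (exp_ineq1_le 2); lra].
    unfold codes. rewrite lsum_cons, lsum_flat_map, lsum_seq.
    assert (H0 : exp (- cval (0, O) ^ 2) = 1).
    { rewrite <- exp_0. f_equal. unfold cval. simpl. ring. }
    rewrite H0.
    assert (H : sumR N (fun s => lsum [(1, s); (-1, s)] (fun c => exp (- cval c ^ 2)))
       <= sumR N (fun s => 2 * (/ 2 * / 2 ^ s))).
    { apply sumR_le; intros s _. unfold lsum; simpl. unfold cval; simpl.
      assert (Hp : 0 < 2 ^ s) by (apply pow_lt; lra).
      (* From $e^x\ge 1+x$ at $x=4^s$, together with $4^s+1\ge 2\cdot 2^s$. *)
      assert (Hs : exp (- (2 ^ s * 2 ^ s)) <= / 2 * / 2 ^ s).
      { rewrite exp_Ropp, <- Rinv_mult. apply Rinv_le_contravar; [lra|].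
        pose proof (exp_ineq1_le (2 ^ s * 2 ^ s)).
        pose proof (Rle_0_sqr (2 ^ s - 1)) as Hq. unfold Rsqr in Hq. lra. }
      match goal with |- exp ?a + (exp ?b + 0) <= _ =>
        replace a with (- (2 ^ s * 2 ^ s)) by ring;
        replace b with (- (2 ^ s * 2 ^ s)) by ring end.
      lra. }
    rewrite sumR_scal in H. pose proof (sum_half_pow_le N). lra. }
  apply pow_incr with (n := n) in HQ. rewrite exp_pow in HQ.
  eapply Rle_trans; [apply Rmult_le_compat_l; [left; apply exp_pos|exact HQ]|].
  rewrite <- exp_plus. eapply Rle_trans; [|exact exp_neg_1_le]. apply exp_le. lra.
Qed.

Definition sign_fun (v : list R) : nat -> R := fun i => nth i v 0.

Definition level_signs (n N : nat) : list (nat * list R) :=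
  list_prod (seq 0 N) (vecs n [0; 1; -1]).

(** One coordinate contributes $1+2e^{-2s}\le 1+2/4^s\le e^{2/4^s}$, whose $n$-th power the penalty
    cancels. What remains, $e^{-s-2}$, sums over levels to at most $1/2$. *)
Lemma heavy_weight_le n N :
  lsum (level_signs n N) (fun p => exp (- heavy_penalty n (fst p) (sign_fun (snd p)))) <= / 2.
Proof.
  unfold level_signs. rewrite lsum_list_prod, lsum_seq. simpl.
  apply Rle_trans with (sumR N (fun s => / 2 * (/ 2 * / 2 ^ s))).
  2:{ rewrite sumR_scal. pose proof (sum_half_pow_le N). lra. }
  apply sumR_le; intros s _.
  rewrite (lsum_ext _ _ (fun v => exp (- (2 * INR n / 4 ^ s + INR s + 2)) *
    exp (sumR n (fun i => - (2 * INR s) * (nth i v 0) ^ 2)))).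
  2:{ intros v _. rewrite <- exp_plus. f_equal. unfold heavy_penalty, sign_fun.
      rewrite sumR_scal. ring. }
  rewrite lsum_scal, (lsum_vecs_exp n [0; 1; -1] 0 (fun r => - (2 * INR s) * r ^ 2)).
  assert (H4 : 0 < 4 ^ s) by (apply pow_lt; lra).
  assert (HQ : 0 <= lsum [0; 1; -1] (fun r => exp (- (2 * INR s) * r ^ 2)) <= exp (2 / 4 ^ s)).
  { split; [apply lsum_nonneg; intros; left; apply exp_pos|].
    unfold lsum; simpl.
    replace (- (2 * INR s) * (0 * (0 * 1))) with 0 by ring.
    replace (- (2 * INR s) * (1 * (1 * 1))) with (- INR s + - INR s) by ring.
    replace (- (2 * INR s) * (-1 * (-1 * 1))) with (- INR s + - INR s) by ring.
    rewrite exp_0, exp_plus. eapply Rle_trans; [|apply exp_ineq1_le].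
    assert (Hs : exp (- INR s) * exp (- INR s) <= / 4 ^ s).
    { rewrite four_pow, Rinv_mult.
      apply Rmult_le_compat; try (left; apply exp_pos); apply exp_neg_INR_le. }
    unfold Rdiv. lra. }
  apply pow_incr with (n := n) in HQ. rewrite exp_pow in HQ.
  eapply Rle_trans; [apply Rmult_le_compat_l; [left; apply exp_pos|apply HQ]|].
  rewrite <- exp_plus.
  replace (- (2 * INR n / 4 ^ s + INR s + 2) + INR n * (2 / 4 ^ s))
    with (-1 + (-1 + - INR s)) by (field; lra).
  rewrite !exp_plus. pose proof (exp_pos (-1)). pose proof (exp_pos (- INR s)).
  repeat (apply Rmult_le_compat; try apply exp_neg_1_le; try apply exp_neg_INR_le; try nra).
Qed.

(** Each test pairs a matrix with its penalty. Vectors are stored as lists so that the family is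
    finite; heavy tests record the level beside the signs because the penalty depends on it. *)
Definition tests (n N : nat) : list ((nat -> nat -> R) * R) :=
  map (fun p => (light n (code_fun (fst p)) (code_fun (snd p)),
                 light_penalty n (code_fun (fst p)) + light_penalty n (code_fun (snd p))))
    (list_prod (vecs n (codes N)) (vecs n (codes N))) ++
  map (fun p => (tensor (sign_fun (snd (fst p))) (sign_fun (snd (snd p))),
                 heavy_penalty n (fst (fst p)) (sign_fun (snd (fst p))) +
                 heavy_penalty n (fst (snd p)) (sign_fun (snd (snd p)))))
    (list_prod (level_signs n N) (level_signs n N)).

(** Weights of pairs are products, so the light and the heavy tests have total weight at most
    $(1/2)^2$ each. *)
Lemma tests_weight_le n N : lsum (tests n N) (fun t => exp (- snd t)) <= 1 / 2.
Proof.
  unfold tests. rewrite lsum_app, !lsum_map. simpl.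
  rewrite (lsum_ext _ _ (fun p => exp (- light_penalty n (code_fun (fst p))) *
    exp (- light_penalty n (code_fun (snd p)))))
    by (intros; rewrite <- exp_plus; f_equal; ring).
  rewrite (lsum_ext (list_prod (level_signs n N) _) _ (fun p =>
     exp (- heavy_penalty n (fst (fst p)) (sign_fun (snd (fst p)))) *
     exp (- heavy_penalty n (fst (snd p)) (sign_fun (snd (snd p))))))
    by (intros; rewrite <- exp_plus; f_equal; ring).
  rewrite (lsum_mult _ _ (fun l => exp (- light_penalty n (code_fun l)))
                         (fun l => exp (- light_penalty n (code_fun l)))).
  rewrite (lsum_mult _ _ (fun p => exp (- heavy_penalty n (fst p) (sign_fun (snd p))))
                         (fun p => exp (- heavy_penalty n (fst p) (sign_fun (snd p))))).
  pose proof (light_weight_le n N) as HL. pose proof (heavy_weight_le n N) as HH.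
  set (a := lsum _ _) in HL. set (b := lsum _ _) in HH. fold a b.
  assert (0 <= a) by (apply lsum_nonneg; intros; left; apply exp_pos).
  assert (0 <= b) by (apply lsum_nonneg; intros; left; apply exp_pos).
  nra.
Qed.

Lemma tests_bounded n N t i j :
  (0 < n)%nat -> In t (tests n N) -> (i < n)%nat -> (j < n)%nat -> Rabs (fst t i j) <= 1.
Proof.
  intros Hn Ht Hi Hj. apply in_app_or in Ht.
  destruct Ht as [Ht|Ht]; apply in_map_iff in Ht as ([l l'] & <- & Hl);
    apply in_prod_iff in Hl as [Hl Hl']; cbn [fst snd].
  - unfold light, code_fun, cval.
    destruct (in_codes N _ (vecs_nth n _ l (0, O) i Hl Hi)) as (Hc & _).
    destruct (in_codes N _ (vecs_nth n _ l' (0, O) j Hl' Hj)) as (Hd & _).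
    destruct (nth i l (0, O)) as [e s], (nth j l' (0, O)) as [e' s'].
    cbn [fst snd] in *.
    assert (Hr : 0 < sqrt (INR n)) by (apply sqrt_lt_R0, lt_0_INR; lia).
    assert (0 < 2 ^ s) by (apply pow_lt; lra). assert (0 < 2 ^ s') by (apply pow_lt; lra).
    destruct (Rle_dec _ _); [|rewrite Rabs_R0; lra].
    replace (e * 2 ^ s * (e' * 2 ^ s') / sqrt (INR n))
      with ((e * e') * (2 ^ s * 2 ^ s' / sqrt (INR n))) by (field; lra).
    assert (Hq : 0 <= 2 ^ s * 2 ^ s' / sqrt (INR n) <= 1).
    { split.
      - apply Rmult_le_pos; [nra|]. left. apply Rinv_0_lt_compat, Hr.
      - apply Rmult_le_reg_r with (sqrt (INR n)); [exact Hr|]. unfold Rdiv.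
        rewrite Rmult_assoc, Rinv_l by lra. lra. }
    apply Rabs_le. destruct Hc as [->|[->| ->]], Hd as [->|[->| ->]]; lra.
  - unfold level_signs in Hl, Hl'. destruct l as [s v], l' as [s' v'].
    apply in_prod_iff in Hl as [_ Hv]. apply in_prod_iff in Hl' as [_ Hv'].
    simpl. unfold tensor, sign_fun.
    pose proof (vecs_nth n _ v 0 i Hv Hi) as H1. pose proof (vecs_nth n _ v' 0 j Hv' Hj) as H2.
    simpl in H1, H2. apply Rabs_le.
    destruct H1 as [<-|[<-|[<-|[]]]], H2 as [<-|[<-|[<-|[]]]]; lra.
Qed.

(** The deterministic half: passing all tests bounds the bilinear form on rounded vectors by
    $334nr$. Each of two applications of [dyadic_dual] then costs a factor $2/r$, giving
    $1336n/r=1336r$. *)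
Lemma tests_norm n N x :
  (0 < n)%nat -> 2 * sqrt (INR n) < 2 ^ N <= 4 * sqrt (INR n) ->
  (forall t, In t (tests n N) -> pairing n (fst t) x <= pairing n (fst t) (fst t) + snd t) ->
  forall v, vnorm n v = 1 -> vnorm n (mulmv n x v) <= 1336 * sqrt (INR n).
Proof.
  intros Hn [HN1 HN2] Htests.
  assert (Hn' : 1 <= INR n) by (change 1 with (INR 1); apply le_INR; lia).
  set (r := sqrt (INR n)) in *.
  assert (Hr : 0 < r) by (apply sqrt_lt_R0; lra).
  assert (Hrr : r * r = INR n) by (apply sqrt_sqrt; lra).
  (* The code of zero sits at level 0, so level 0 must be among the levels below [N]. *)
  assert (HN0 : (0 < N)%nat).
  { destruct N; [|lia]. simpl in HN1. nra. }
  assert (Hbil : forall c d,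
    (forall i, In (c i) (codes N)) -> (forall i, In (d i) (codes N)) ->
    sumR n (fun i => cval (c i) ^ 2) <= 4 * INR n ->
    sumR n (fun i => cval (d i) ^ 2) <= 4 * INR n ->
    pairing n (tensor (fun i => cval (c i)) (fun j => cval (d j))) x <= 334 * INR n * r).
  { intros c d Hc Hd Hcn Hdn.
    assert (Hlev : forall c, In c (codes N) -> (snd c < N)%nat).
    { intros c0 H0. destruct (in_codes N c0 H0) as (_ & [H1|H1]); [exact H1|].
      rewrite H1. exact HN0. }
    assert (Hsl : forall (c : nat -> R * nat) s i, In (c i) (codes N) -> In (slice c s i) [0; 1; -1]).
    { intros c0 s i H0. destruct (in_codes N _ H0) as (H1 & _). unfold slice.
      destruct (Nat.eqb s _); simpl; intuition auto. }
    assert (Hcf : forall (c : nat -> R * nat) i, (i < n)%nat -> code_fun (map c (seq 0 n)) i = c i).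
    { intros c0 i Hi. apply nth_map_seq, Hi. }
    assert (Hsf : forall u i, (i < n)%nat -> sign_fun (map u (seq 0 n)) i = u i).
    { intros u i Hi. apply nth_map_seq, Hi. }
    apply (dyadic_bilinear_bound n N x c d); auto.
    - set (l := map c (seq 0 n)). set (l' := map d (seq 0 n)).
      specialize (Htests (light n (code_fun l) (code_fun l'),
        light_penalty n (code_fun l) + light_penalty n (code_fun l'))).
      cbn [fst snd] in Htests.
      (* The stored lists agree with [c] and [d] only at indices below [n], which is all that
         [pairing] reads. *)
      assert (Hlt : forall i j, (i < n)%nat -> (j < n)%nat ->
        light n (code_fun l) (code_fun l') i j = light n c d i j).
      { intros i j Hi Hj. unfold light, l, l'. rewrite !Hcf by assumption. reflexivity. }
      assert (Hpen : forall c, light_penalty n (code_fun (map c (seq 0 n))) = light_penalty n c).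
      { intros c0. unfold light_penalty.
        rewrite (sumR_ext n _ (fun i => cval (c0 i) ^ 2)); [reflexivity|].
        intros; rewrite Hcf by assumption; reflexivity. }
      rewrite <- (Hpen c), <- (Hpen d). fold l l'.
      rewrite (pairing_ext n (light n c d) (light n (code_fun l) (code_fun l')) x x)
        by (intros; rewrite Hlt by assumption; reflexivity).
      rewrite (pairing_ext n (light n c d) (light n (code_fun l) (code_fun l'))
        (light n c d) (light n (code_fun l) (code_fun l')))
        by (intros; rewrite Hlt by assumption; reflexivity).
      apply Htests. apply in_or_app. left.
      apply in_map_iff. exists (l, l'). split; [reflexivity|].
      apply in_prod; apply in_vecs; auto.
    - intros s t Hs Ht.
      set (u := map (slice c s) (seq 0 n)). set (v := map (slice d t) (seq 0 n)).
      specialize (Htests (tensor (sign_fun u) (sign_fun v),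
        heavy_penalty n s (sign_fun u) + heavy_penalty n t (sign_fun v))).
      cbn [fst snd] in Htests.
      assert (Hten : forall i j, (i < n)%nat -> (j < n)%nat ->
        tensor (sign_fun u) (sign_fun v) i j = tensor (slice c s) (slice d t) i j).
      { intros i j Hi Hj. unfold tensor, u, v. rewrite !Hsf by assumption. reflexivity. }
      assert (Hpen : forall q w, heavy_penalty n q (sign_fun (map w (seq 0 n))) = heavy_penalty n q w).
      { intros q w. unfold heavy_penalty.
        rewrite (sumR_ext n _ (fun i => w i ^ 2)); [reflexivity|].
        intros; rewrite Hsf by assumption; reflexivity. }
      rewrite <- (Hpen s (slice c s)), <- (Hpen t (slice d t)). fold u v.
      rewrite (pairing_ext n (tensor (slice c s) (slice d t)) (tensor (sign_fun u) (sign_fun v)) x x)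
        by (intros; rewrite Hten by assumption; reflexivity).
      rewrite (pairing_ext n (tensor (slice c s) (slice d t)) (tensor (sign_fun u) (sign_fun v))
        (tensor (slice c s) (slice d t)) (tensor (sign_fun u) (sign_fun v)))
        by (intros; rewrite Hten by assumption; reflexivity).
      apply Htests. apply in_or_app. right.
      apply in_map_iff. exists ((s, u), (t, v)). split; [reflexivity|].
      apply in_prod; apply in_prod; try (apply in_seq; lia); apply in_vecs; auto. }
  intros v Hv.
  replace (1336 * r) with (2 * (668 * INR n) / r) by (rewrite <- Hrr; field; lra).
  apply (dyadic_dual n N); [exact Hn|exact HN1|]. intros c Hc Hcn.
  (* The transpose of [x] applied to the rounded left vector; a second duality bounds its norm, so
     that both sides of the bilinear form are rounded. *)
  set (f := fun j => sumR n (fun i => cval (c i) * x i j)).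
  assert (Hf : vnorm n f <= 668 * INR n).
  { replace (668 * INR n) with (2 * (334 * INR n * r) / r) by (field; lra).
    apply (dyadic_dual n N); [exact Hn|exact HN1|]. intros d Hd Hdn.
    eapply Rle_trans; [|apply (Hbil c d); auto]. right.
    unfold pairing. rewrite sumR_swap. apply sumR_ext; intros j _.
    rewrite Rmult_comm. unfold f. rewrite <- sumR_scal. apply sumR_ext; intros.
    unfold tensor. ring. }
  pose proof (cauchy_schwarz n f v) as HCS. rewrite Hv in HCS.
  replace (sumR n (fun i => mulmv n x v i * cval (c i))) with (sumR n (fun i => f i * v i)); [lra|].
  symmetry.
  rewrite (sumR_ext n _ (fun i => sumR n (fun j => cval (c i) * x i j * v j))).
  - rewrite sumR_swap. apply sumR_ext; intros j _. unfold f.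
    rewrite Rmult_comm, <- sumR_scal. apply sumR_ext; intros. ring.
  - intros i _. unfold mulmv. rewrite Rmult_comm, <- sumR_scal. apply sumR_ext; intros. ring.
Qed.

Lemma dyadic_scale_exists y : 1 <= y -> exists N, y < 2 ^ N <= 2 * y.
Proof.
  intros Hy. destruct (INR_unbounded y) as [M HM].
  destruct (dyadic_floor M y) as (s & _ & H1 & H2).
  - pose proof (INR_le_pow2 M). lra.
  - exists (S s). simpl in *. lra.
Qed.

(** The moment hypothesis says that entries are subexponential at scale 1. Taking as exponent the
    pairing minus the energy minus the penalty, each test has exponential moment at most its
    weight. *)
Lemma random_matrix_norm {W : Type} (Om : list W) (P : W -> R) (x : W -> nat -> nat -> R) n :
  (0 < n)%nat -> (forall w, In w Om -> 0 <= P w) -> lsum Om P = 1 ->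
  (forall th, (forall i j, (i < n)%nat -> (j < n)%nat -> Rabs (th i j) <= 1) ->
     lsum Om (fun w => P w * exp (pairing n th (x w))) <= exp (pairing n th th)) ->
  1 / 2 <= lsum Om (fun w => P w * indic
    (forall v, vnorm n v = 1 -> vnorm n (mulmv n (x w) v) <= 1336 * sqrt (INR n))).
Proof.
  intros Hn HP H1 Hmgf.
  assert (Hr : 1 <= sqrt (INR n)).
  { rewrite <- sqrt_1 at 1. apply sqrt_le_1_alt. change 1 with (INR 1). apply le_INR. lia. }
  destruct (dyadic_scale_exists (2 * sqrt (INR n))) as (N & HN); [lra|].
  apply exponential_union_bound with (tests := tests n N)
    (F := fun t w => pairing n (fst t) (x w) + (- pairing n (fst t) (fst t) - snd t)); auto.
  - eapply Rle_trans; [|apply (tests_weight_le n N)]. apply lsum_le; intros t Ht.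
    rewrite (lsum_ext _ _ (fun w => exp (- pairing n (fst t) (fst t) - snd t) *
      (P w * exp (pairing n (fst t) (x w))))) by (intros; rewrite exp_plus; ring).
    rewrite lsum_scal.
    eapply Rle_trans; [apply Rmult_le_compat_l; [left; apply exp_pos|apply Hmgf]|].
    + intros i j Hi Hj. apply (tests_bounded n N); auto.
    + rewrite <- exp_plus. right. f_equal. ring.
  - intros w Hw. apply (tests_norm n N); [exact Hn|lra|].
    intros t Ht. specialize (Hw t Ht). lra.
Qed.

(** * DIMSUM *)

(** Since $e^{-t}\ge 1-t$, one has $e^t(1-t)\le 1\le(1+t+2t^2)(1-t)$, the last product being
    $1+t^2(1-2t)$. *)
Lemma exp_le_quadratic t : t <= / 2 -> exp t <= 1 + t + 2 * t ^ 2.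
Proof.
  intros Ht. pose proof (exp_ineq1_le (- t)) as H. rewrite exp_Ropp in H.
  pose proof (exp_pos t) as Hp.
  assert (H1 : exp t * (1 - t) <= 1).
  { apply Rle_trans with (exp t * / exp t); [apply Rmult_le_compat_l; lra|].
    rewrite Rinv_r; lra. }
  assert (H2 : 1 <= (1 + t + 2 * t ^ 2) * (1 - t)).
  { replace ((1 + t + 2 * t ^ 2) * (1 - t)) with (1 + t ^ 2 * (1 - 2 * t)) by ring.
    pose proof (Rmult_le_pos (t ^ 2) (1 - 2 * t) (pow2_ge_0 t) ltac:(lra)). lra. }
  apply Rmult_le_reg_r with (1 - t); lra.
Qed.

(** The two values $y(1/p-1)$ and $-y$ have mean 0 and variance $y^2(1/p-1)$. Both are at most $1/2$
    when $|y|/p\le 1/2$, so the quadratic bound applies; when $p=1$ the coin is deterministic. *)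
Lemma coin_mgf_le p y :
  0 < p <= 1 -> p = 1 \/ Rabs y / p <= / 2 ->
  p * exp (y * (1 / p - 1)) + (1 - p) * exp (y * (0 / p - 1)) <=
  exp (2 * y ^ 2 * (/ p - 1)).
Proof.
  intros [Hp0 Hp1] [->|Hy].
  - replace (y * (1 / 1 - 1)) with 0 by field.
    replace (2 * y ^ 2 * (/ 1 - 1)) with 0 by field. rewrite exp_0. lra.
  - assert (Hip : 1 <= / p) by (rewrite <- Rinv_1; apply Rinv_le_contravar; lra).
    unfold Rdiv in Hy. pose proof (Rabs_pos y) as Hay.
    assert (Ht1 : y * (1 / p - 1) <= / 2).
    { apply Rle_trans with (Rabs y * (1 / p - 1)).
      - apply Rmult_le_compat_r; [unfold Rdiv; lra|apply Rle_abs].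
      - unfold Rdiv. nra. }
    assert (Ht2 : y * (0 / p - 1) <= / 2).
    { replace (y * (0 / p - 1)) with (- y) by (field; lra).
      apply Rle_trans with (Rabs y); [rewrite <- Rabs_Ropp; apply Rle_abs|nra]. }
    apply exp_le_quadratic in Ht1, Ht2.
    eapply Rle_trans; [|apply exp_ineq1_le].
    apply Rmult_le_compat_l with (r := p) in Ht1; [|lra].
    apply Rmult_le_compat_l with (r := 1 - p) in Ht2; [|lra].
    eapply Rle_trans; [apply Rplus_le_compat; [exact Ht1|exact Ht2]|].
    right. field. lra.
Qed.

(** * The error matrix, its variance and its exponential moments *)

Lemma colnorm_sqr m A i : colnorm m A i * colnorm m A i = AtA m A i i.
Proof. exact (vnorm_sqr m (fun k => A k i)). Qed.

Lemma colnorm_pos m A i : colnorm m A i <> 0 -> 0 < colnorm m A i.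
Proof.
  intros H. pose proof (vnorm_nonneg m (fun k => A k i)).
  unfold colnorm, vnorm in *. lra.
Qed.

Lemma pij_cases m A gamma i j :
  0 < gamma -> colnorm m A i <> 0 -> colnorm m A j <> 0 ->
  0 < pij m A gamma i j <= 1 /\
  (pij m A gamma i j = 1 \/
   pij m A gamma i j = gamma / (colnorm m A i * colnorm m A j)).
Proof.
  intros Hg Hi Hj. apply colnorm_pos in Hi, Hj.
  assert (0 < gamma / (colnorm m A i * colnorm m A j)).
  { apply Rmult_lt_0_compat; [lra|]. apply Rinv_0_lt_compat. nra. }
  unfold pij, Rmin. destruct (Rle_dec _ _); split; auto; lra.
Qed.

(** Both branches of [dimsumB] divide by $\|c_i\|\|c_j\|p_{ij}$, so conjugating by $D$ leaves the
    unbiased estimator with factor $1/p_{ij}$. *)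
Lemma dimsum_error_entry m n A gamma w i j :
  0 < gamma -> colnorm m A i <> 0 -> colnorm m A j <> 0 ->
  DBD_minus_AtA m n A gamma w i j =
  sumR m (fun k => A k i * A k j *
    ((if coin n w k i j then 1 else 0) / pij m A gamma i j - 1)).
Proof.
  intros Hg Hi Hj. destruct (pij_cases m A gamma i j Hg Hi Hj) as [Hp _].
  rewrite (sumR_ext m _ (fun k => / pij m A gamma i j * Xv m n A w i j k +
    (-1) * (A k i * A k j))).
  2:{ intros k _. unfold Xv. destruct (coin n w k i j); field; lra. }
  rewrite sumR_plus, (sumR_scal m _ (fun k => Xv m n A w i j k)), sumR_scal.
  unfold DBD_minus_AtA, dimsumB, AtA.
  apply colnorm_pos in Hi, Hj. unfold pij in *.
  destruct (Rle_dec _ 1) as [H|H].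
  - rewrite Rmin_right by exact H. field. lra.
  - rewrite Rmin_left by lra. field. lra.
Qed.

Lemma weight_nonneg m n A gamma w :
  0 < gamma -> (forall i, (i < n)%nat -> colnorm m A i <> 0) -> 0 <= weight m n A gamma w.
Proof.
  intros Hg HA. unfold weight.
  apply prodR_nonneg; intros k _. apply prodR_nonneg; intros i Hi.
  apply prodR_nonneg; intros j Hj.
  destruct (pij_cases m A gamma i j Hg (HA i Hi) (HA j Hj)) as [Hp _].
  destruct (coin n w k i j); lra.
Qed.

Lemma weight_total m n A gamma :
  lsum (bool_lists (m * n * n)) (weight m n A gamma) = 1.
Proof.
  unfold weight.
  rewrite (lsum_coins m n (fun k i j b =>
    if b then pij m A gamma i j else 1 - pij m A gamma i j)).
  transitivity (prodR m (fun _ => 1)); [|apply prodR_one].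
  apply prodR_ext; intros k _. transitivity (prodR n (fun _ => 1)); [|apply prodR_one].
  apply prodR_ext; intros i _. transitivity (prodR n (fun _ => 1)); [|apply prodR_one].
  apply prodR_ext; intros j _. ring.
Qed.

(** The variance vanishes if $p_{ij}=1$. Otherwise $1/p_{ij}\le S/\gamma$ by the inequality of
    arithmetic and geometric means, and $|a_{kj}|\le 1$ bounds the sum by $\|c_i\|^2\le S$. *)
Lemma dimsum_entry_variance_le m n A gamma S i j :
  (forall k i, (k < m)%nat -> (i < n)%nat -> -1 <= A k i <= 1) ->
  (forall i, (i < n)%nat -> colnorm m A i <> 0) ->
  (forall i, (i < n)%nat -> AtA m A i i <= S) ->
  0 < gamma -> (i < n)%nat -> (j < n)%nat ->
  (/ pij m A gamma i j - 1) * sumR m (fun k => (A k i * A k j) ^ 2) <= S ^ 2 / gamma.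
Proof.
  intros HA Hc HS Hg Hi Hj.
  destruct (pij_cases m A gamma i j Hg (Hc i Hi) (Hc j Hj)) as [Hp Hcase].
  assert (Hin : 0 < / gamma) by (apply Rinv_0_lt_compat, Hg).
  destruct Hcase as [->|Heq].
  - rewrite Rinv_1, Rminus_diag, Rmult_0_l.
    apply Rmult_le_pos; [apply pow2_ge_0|lra].
  - pose proof (colnorm_pos m A i (Hc i Hi)) as Hci.
    pose proof (colnorm_pos m A j (Hc j Hj)) as Hcj.
    pose proof (HS i Hi) as HSi. pose proof (HS j Hj) as HSj. rewrite <- colnorm_sqr in HSi, HSj.
    assert (Hq : colnorm m A i * colnorm m A j <= S).
    { pose proof (Rle_0_sqr (colnorm m A i - colnorm m A j)) as H. unfold Rsqr in H. lra. }
    assert (Hsum : 0 <= sumR m (fun k => (A k i * A k j) ^ 2) <= S).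
    { split; [apply sumR_nonneg; intros; apply pow2_ge_0|].
      eapply Rle_trans; [|exact HSi]. rewrite colnorm_sqr. unfold AtA.
      apply sumR_le; intros k Hk.
      pose proof (HA k j Hk Hj).
      replace ((A k i * A k j) ^ 2) with (A k i * A k i * (A k j * A k j)) by ring.
      rewrite <- (Rmult_1_r (A k i * A k i)) at 2. apply Rmult_le_compat_l; nra. }
    rewrite Heq.
    replace (/ (gamma / (colnorm m A i * colnorm m A j)))
      with (colnorm m A i * colnorm m A j * / gamma) by (field; lra).
    apply Rle_trans with (S * / gamma * S); [|right; unfold Rdiv; ring].
    apply Rle_trans with (S * / gamma * sumR m (fun k => (A k i * A k j) ^ 2)).
    + apply Rmult_le_compat_r; [lra|].
      pose proof (Rmult_le_compat_r (/ gamma) _ _ ltac:(lra) Hq). lra.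
    + apply Rmult_le_compat_l; [|lra]. apply Rmult_le_pos; nra.
Qed.

(** Independence reduces the moment to single coins. The scale $\sqrt\gamma/(2S)$ keeps every jump
    within $1/2$ and makes each entry's variance at most $1/4$. *)
Lemma dimsum_mgf m n A gamma S th :
  (forall k i, (k < m)%nat -> (i < n)%nat -> -1 <= A k i <= 1) ->
  (forall i, (i < n)%nat -> colnorm m A i <> 0) ->
  (forall i, (i < n)%nat -> AtA m A i i <= S) ->
  0 < S -> 1 <= gamma ->
  (forall i j, (i < n)%nat -> (j < n)%nat -> Rabs (th i j) <= 1) ->
  lsum (bool_lists (m * n * n)) (fun w => weight m n A gamma w *
    exp (pairing n th (fun i j => sqrt gamma / (2 * S) * DBD_minus_AtA m n A gamma w i j))) <=
  exp (pairing n th th).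
Proof.
  intros HA Hc HS HS0 Hg Hth.
  set (r := sqrt gamma). assert (Hr1 : 1 <= r) by (rewrite <- sqrt_1; apply sqrt_le_1_alt, Hg).
  assert (Hrr : r * r = gamma) by (apply sqrt_sqrt; lra).
  set (y := fun k i j => th i j * (r / (2 * S)) * (A k i * A k j)).
  rewrite (lsum_ext _ _ (fun w => prodR m (fun k => prodR n (fun i => prodR n (fun j =>
    (if coin n w k i j then pij m A gamma i j else 1 - pij m A gamma i j) *
    exp (y k i j * ((if coin n w k i j then 1 else 0) / pij m A gamma i j - 1))))))).
  (* Written as a sum over coins, the exponent merges with the weight into one product, ready for
     [lsum_coins]. *)
  2:{ intros w _.
      set (z := fun k i j =>
        y k i j * ((if coin n w k i j then 1 else 0) / pij m A gamma i j - 1)).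
      replace (pairing n th _) with (sumR m (fun k => sumR n (fun i => sumR n (fun j => z k i j)))).
      2:{ rewrite sumR_swap. apply sumR_ext; intros i Hi.
          rewrite sumR_swap. apply sumR_ext; intros j Hj.
          rewrite dimsum_error_entry by (auto; lra).
          rewrite <- !sumR_scal. apply sumR_ext; intros k _. unfold z, y. ring. }
      unfold weight. rewrite <- prodR_exp, <- prodR_mult. apply prodR_ext; intros k _.
      rewrite <- prodR_exp, <- prodR_mult. apply prodR_ext; intros i _.
      rewrite <- prodR_exp, <- prodR_mult. apply prodR_ext; intros j _. reflexivity. }
  rewrite (lsum_coins m n (fun k i j b => (if b then pij m A gamma i j else 1 - pij m A gamma i j) *
    exp (y k i j * ((if b then 1 else 0) / pij m A gamma i j - 1)))).
  apply Rle_trans with (prodR m (fun k => prodR n (fun i => prodR n (fun j =>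
    exp (2 * y k i j ^ 2 * (/ pij m A gamma i j - 1)))))).
  - assert (Hfac : forall k i j, (k < m)%nat -> (i < n)%nat -> (j < n)%nat ->
      0 <= pij m A gamma i j * exp (y k i j * (1 / pij m A gamma i j - 1)) +
       (1 - pij m A gamma i j) * exp (y k i j * (0 / pij m A gamma i j - 1)) <=
      exp (2 * y k i j ^ 2 * (/ pij m A gamma i j - 1))).
    { intros k i j Hk Hi Hj.
      destruct (pij_cases m A gamma i j ltac:(lra) (Hc i Hi) (Hc j Hj)) as [Hp Hcase].
      split.
      - apply Rplus_le_le_0_compat; apply Rmult_le_pos; try lra; left; apply exp_pos.
      - apply coin_mgf_le; [exact Hp|]. destruct Hcase as [H1|H1]; [left; exact H1|right].
        pose proof (colnorm_pos m A i (Hc i Hi)) as Hci.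
        pose proof (colnorm_pos m A j (Hc j Hj)) as Hcj.
        pose proof (HS i Hi) as HSi. pose proof (HS j Hj) as HSj.
        rewrite <- colnorm_sqr in HSi, HSj.
        assert (Hq : colnorm m A i * colnorm m A j <= S).
        { pose proof (Rle_0_sqr (colnorm m A i - colnorm m A j)) as H. unfold Rsqr in H. lra. }
        assert (Hrs : 0 < r / (2 * S)).
        { apply Rmult_lt_0_compat; [lra|]. apply Rinv_0_lt_compat. lra. }
        assert (Hy : Rabs (y k i j) <= r / (2 * S)).
        { unfold y. rewrite !Rabs_mult, (Rabs_pos_eq (r / (2 * S))) by lra.
          assert (Ha : forall l, (l < n)%nat -> Rabs (A k l) <= 1).
          { intros l Hl. apply Rabs_le, HA; assumption. }
          pose proof (Ha i Hi). pose proof (Ha j Hj). pose proof (Hth i j Hi Hj).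
          pose proof (Rabs_pos (A k i)). pose proof (Rabs_pos (A k j)).
          pose proof (Rabs_pos (th i j)).
          assert (0 <= Rabs (A k i) * Rabs (A k j) <= 1) by nra.
          rewrite <- (Rmult_1_l (r / (2 * S))) at 2.
          rewrite <- (Rmult_1_r (1 * (r / (2 * S)))).
          apply Rmult_le_compat; try lra; [nra|].
          apply Rmult_le_compat_r; lra. }
        rewrite H1.
        replace (Rabs (y k i j) / (gamma / (colnorm m A i * colnorm m A j)))
          with (Rabs (y k i j) * (colnorm m A i * colnorm m A j / gamma)) by (field; lra).
        (* The jump is at most $1/(2\sqrt\gamma)$; this is where $\gamma\ge 1$ enters. *)
        apply Rle_trans with (r / (2 * S) * (S / gamma)).
        + apply Rmult_le_compat; [apply Rabs_pos| |exact Hy|].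
          * apply Rmult_le_pos; [nra|]. left. apply Rinv_0_lt_compat. lra.
          * apply Rmult_le_compat_r; [|exact Hq]. left. apply Rinv_0_lt_compat. lra.
        + rewrite <- Hrr. replace (r / (2 * S) * (S / (r * r))) with (/ 2 * / r) by (field; lra).
          assert (/ r <= 1) by (rewrite <- Rinv_1; apply Rinv_le_contravar; lra). lra. }
    apply prodR_le; intros k Hk; split.
    { apply prodR_nonneg; intros i Hi; apply prodR_nonneg; intros j Hj. apply Hfac; assumption. }
    apply prodR_le; intros i Hi; split.
    { apply prodR_nonneg; intros j Hj. apply Hfac; assumption. }
    apply prodR_le; intros j Hj. apply Hfac; assumption.
  - rewrite (prodR_ext m _ (fun k => exp (sumR n (fun i => sumR n (fun j =>
      2 * y k i j ^ 2 * (/ pij m A gamma i j - 1)))))).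
    2:{ intros k _. rewrite <- prodR_exp. apply prodR_ext; intros i _. apply prodR_exp. }
    rewrite prodR_exp. apply exp_le. rewrite sumR_swap. apply sumR_le; intros i Hi.
    rewrite sumR_swap. apply sumR_le; intros j Hj.
    rewrite (sumR_ext m _ (fun k => 2 * (th i j * (r / (2 * S))) ^ 2 * (/ pij m A gamma i j - 1) *
      (A k i * A k j) ^ 2)) by (intros; unfold y; ring).
    rewrite sumR_scal, Rmult_assoc.
    eapply Rle_trans.
    { apply Rmult_le_compat_l; [|apply (dimsum_entry_variance_le m n A gamma S); auto; lra].
      pose proof (pow2_ge_0 (th i j * (r / (2 * S)))). lra. }
    rewrite <- Hrr.
    (* The exponent is half of the squared entry of [th], within the allowed bound. *)
    replace (2 * (th i j * (r / (2 * S))) ^ 2 * (S ^ 2 / (r * r)))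
      with (/ 2 * (th i j * th i j)) by (field; lra).
    pose proof (Rle_0_sqr (th i j)) as H. unfold Rsqr in H. lra.
Qed.

Theorem theorem2 :
  exists C : R, C > 0 /\
  forall (m n : nat) (A : nat -> nat -> R),
    (0 < n)%nat -> (n < m)%nat ->
    (forall k i, (k < m)%nat -> (i < n)%nat -> -1 <= A k i <= 1) ->
    (forall i, (i < n)%nat -> colnorm m A i <> 0) ->
    forall eps gamma : R,
      eps > 0 -> gamma >= C * INR n / eps ^ 2 -> gamma >= 1 ->
      dimsum_prob m n A gamma
        (fun w => opnorm n (DBD_minus_AtA m n A gamma w) / opnorm n (AtA m A) <= eps)
      >= 1 / 2.
Proof.
  (* $2672=2\cdot 1336$: undoing the scale $\sqrt\gamma/(2S)$ turns $1336\sqrt n$ into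
     $2672\,S\sqrt{n/\gamma}\le\epsilon S$. *)
  exists (2672 ^ 2). split; [lra|].
  intros m n A Hn _ HA Hc eps gamma Heps Hgam Hg1. apply Rle_ge. apply Rge_le in Hg1.
  set (S := opnorm n (AtA m A)).
  assert (HS : forall i, (i < n)%nat -> AtA m A i i <= S).
  { intros i Hi. apply diag_le_opnorm, Hi. }
  assert (HS0 : 0 < S).
  { apply Rlt_le_trans with (AtA m A 0 0); [|apply HS, Hn]. rewrite <- colnorm_sqr.
    pose proof (colnorm_pos m A 0 (Hc O Hn)). nra. }
  set (r := sqrt gamma). assert (Hr : 0 < r) by (apply sqrt_lt_R0; lra).
  assert (Hrr : r * r = gamma) by (apply sqrt_sqrt; lra).
  assert (Hsqrt : 2672 * sqrt (INR n) <= eps * r).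
  { replace (eps * r) with (2672 * (eps * r / 2672)) by field.
    apply Rmult_le_compat_l; [lra|].
    assert (H0 : 0 <= eps * r / 2672) by nra.
    rewrite <- (sqrt_square _ H0). apply sqrt_le_1_alt.
    replace (eps * r / 2672 * (eps * r / 2672)) with (eps ^ 2 * (r * r) / 2672 ^ 2) by field.
    rewrite Hrr. apply Rge_le in Hgam.
    apply Rmult_le_compat_l with (r := eps ^ 2 / 2672 ^ 2) in Hgam; [|nra].
    replace (eps ^ 2 / 2672 ^ 2 * (2672 ^ 2 * INR n / eps ^ 2)) with (INR n) in Hgam
      by (field; lra). lra. }
  pose proof (random_matrix_norm (bool_lists (m * n * n)) (weight m n A gamma)
    (fun w i j => r / (2 * S) * DBD_minus_AtA m n A gamma w i j) n Hn
    (fun w _ => weight_nonneg m n A gamma w ltac:(lra) Hc) (weight_total m n A gamma)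
    (fun th Hth => dimsum_mgf m n A gamma S th HA Hc HS HS0 Hg1 Hth)) as Hmain.
  (* The event of small rescaled norm lies inside the target event, so the indicators are compared
     outcome by outcome. *)
  eapply Rle_trans; [exact Hmain|]. apply lsum_le; intros w _.
  apply Rmult_le_compat_l; [apply weight_nonneg; auto; lra|].
  set (E := DBD_minus_AtA m n A gamma w).
  destruct (indic_cases (forall v, vnorm n v = 1 -> vnorm n (mulmv n
    (fun i j => r / (2 * S) * E i j) v) <= 1336 * sqrt (INR n))) as [[Hgood ->]|[_ ->]].
  2:{ destruct (indic_cases (opnorm n E / S <= eps)) as [[_ ->]|[_ ->]]; lra. }
  destruct (indic_cases (opnorm n E / S <= eps)) as [[_ ->]|[Hbad _]]; [lra|].
  exfalso. apply Hbad. apply Rmult_le_reg_r with S; [exact HS0|].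
  replace (opnorm n E / S * S) with (opnorm n E) by (field; lra).
  apply opnorm_le; [exact Hn|]. intros v Hv. specialize (Hgood v Hv).
  assert (Hrs : 0 < r / (2 * S)).
  { apply Rmult_lt_0_compat; [lra|]. apply Rinv_0_lt_compat. lra. }
  rewrite (vnorm_ext n _ (fun i => r / (2 * S) * mulmv n E v i)) in Hgood.
  2:{ intros i _. unfold mulmv. rewrite <- sumR_scal. apply sumR_ext; intros. ring. }
  rewrite vnorm_scal in Hgood by lra.
  apply Rmult_le_reg_l with (r / (2 * S)); [exact Hrs|].
  eapply Rle_trans; [exact Hgood|].
  replace (r / (2 * S) * (eps * S)) with (/ 2 * (eps * r)) by (field; lra). lra.
Qed.
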